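(* Let $X$ be an infinite dimensional Banach space with $n(X)>0$. If $\mathcal{K}_v(X)$ is an M-ideal in $\mathcal{L}_v(X)$, then the following hold. (1) If $(x,y)\in X\times X$ satisfies $\|x\|\leq\|y\|$, then $$n(X)\limsup_\beta\|x+x_\beta\|\leq \limsup_\beta\|y+x_\beta\|$$ for every bounded weakly-null net $\{x_\beta\}$ in $X$. (2) If $(x^*,y^* )\in X^*\times X^*$ satisfies $\|x^*\|\leq\|y^*\|$, then $$n(X)\limsup_\beta\|x^*+x^*_\beta\|\leq \limsup_\beta\|y^*+x^*_\beta\|$$ for every bounded weakly-$*$-null net $\{x^*_\beta\}$ in $X^*$.
   Context: Banach spaces are over $\mathbb{K}=\mathbb{R}$ or $\mathbb{C}$; $S_X$ denotes the unit sphere of $X$. $\mathcal{L}(X)$ is the space of bounded linear operators on $X$ and $\mathcal{K}(X)$ its subspace of compact operators. Put $\Pi(X)=\{(x^*,x)\in S_{X^*}\times S_X: x^*(x)=1\}$. The numerical radius of $T\in\mathcal{L}(X)$ is $v(T)=\sup\{|x^*(Tx)|:(x^*,x)\in\Pi(X)\}$, and the numerical index of $X$ is $n(X)=\inf\{v(T):T\in\mathcal{L}(X),\ \|T\|=1\}$. If $n(X)>0$, then $v$ is a norm on $\mathcal{L}(X)$ equivalent to the operator norm; $\mathcal{L}_v(X)$ and $\mathcal{K}_v(X)$ denote $\mathcal{L}(X)$ and $\mathcal{K}(X)$ equipped with the norm $v$. A closed subspace $J$ of a Banach space $Z$ is an M-ideal in $Z$ if $Z^*=J^*\oplus_1 J^\perp$,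 i.e. the annihilator $J^\perp$ is the kernel of a linear projection $P$ on $Z^*$ with $\|z^*\|=\|Pz^*\|+\|z^*-Pz^*\|$ for all $z^*\in Z^*$ (the range of $P$ then being identified isometrically with $J^*$). *)

(* Defs.v *)
From HB Require Import structures.
From mathcomp Require Import all_boot all_order all_algebra.
From mathcomp Require Import all_classical all_reals all_analysis.
From mathcomp.real_closed Require Import complex.

Set Implicit Arguments.
Unset Strict Implicit.
Unset Printing Implicit Defensive.

Import Order.TTheory GRing.Theory Num.Theory.
Import numFieldNormedType.Exports.

Local Open Scope classical_set_scope.
Local Open Scope ring_scope.

Variant scalars := RealScalars | ComplexScalars.

Definition scalar_field (R : realType) (s : scalars) : numFieldType :=
  match s with RealScalars => R | ComplexScalars => R[i] end.

Definition of_real (R : realType) (s : scalars) : R -> scalar_field R s :=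
  match s with
  | RealScalars => fun r => r
  | ComplexScalars => fun r => (r%:C)%C
  end.

Definition real_part (R : realType) (s : scalars) : scalar_field R s -> R :=
  match s with
  | RealScalars => fun r => r
  | ComplexScalars => fun z => complex.Re z
  end.

(* Norms are valued in the scalar field; [rnorm] is the same norm seen
   as an element of R, where suprema are available. *)
Definition rnorm (R : realType) (s : scalars)
    (V : normedZmodType (scalar_field R s)) (x : V) : R := real_part `|x|.

Section scalar_lemmas.
Context {R : realType} {s : scalars}.
Local Notation K := (scalar_field R s).

Lemma of_realK : cancel (@of_real R s) (@real_part R s).
Proof. by case: s. Qed.

Lemma real_partK (z : K) : 0 <= z -> of_real s (real_part z) = z.
Proof.
case: s z => //= -[a b]; rewrite lecE /= => /andP[/eqP -> _].
by [].
Qed.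

Lemma real_part_ge0 (z : K) : 0 <= z -> 0 <= real_part z.
Proof. by case: s z => //= -[a b]; rewrite lecE /= => /andP[]. Qed.

Lemma le_real_part (x y : K) : x <= y -> real_part x <= real_part y.
Proof.
by case: s x y => //= -[a b] [c d]; rewrite lecE /= => /andP[].
Qed.

Lemma of_real_le (x y : R) : (of_real s x <= of_real s y) = (x <= y).
Proof. by case: s => //=; rewrite lecE /= eqxx. Qed.

Lemma of_realD (x y : R) : of_real s (x + y) = of_real s x + of_real s y.
Proof. by case: s => //=; rewrite rmorphD. Qed.

Lemma of_realM (x y : R) : of_real s (x * y) = of_real s x * of_real s y.
Proof. by case: s => //=; rewrite rmorphM. Qed.

Lemma of_real0 : of_real s (0 : R) = 0.
Proof. by case: s. Qed.

Lemma of_real1 : of_real s (1 : R) = 1.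
Proof. by case: s. Qed.

Lemma real_partD (x y : K) :
  real_part (x + y) = real_part x + real_part y.
Proof. by case: s x y => //= -[a b] [c d]. Qed.

Section rnorm_lemmas.
Context {V : normedZmodType K}.
Implicit Types x y : V.

Lemma of_real_rnorm x : of_real s (rnorm x) = `|x|.
Proof. exact: real_partK. Qed.

Lemma rnorm_ge0 x : 0 <= rnorm x.
Proof. exact: real_part_ge0. Qed.

Lemma ler_rnormD x y : rnorm (x + y) <= rnorm x + rnorm y.
Proof. by rewrite /rnorm -real_partD; apply/le_real_part/ler_normD. Qed.

Lemma rnorm0 : rnorm (0 : V) = 0.
Proof. by rewrite /rnorm normr0 -[RHS]of_realK of_real0. Qed.

Lemma rnorm_eq0 x : rnorm x = 0 -> x = 0.
Proof. by move=> x0; apply/normr0_eq0; rewrite -of_real_rnorm x0 of_real0. Qed.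

End rnorm_lemmas.

Lemma rnormZ (V : normedModType K) (a : K) (x : V) :
  rnorm (a *: x) = real_part `|a| * rnorm x.
Proof.
apply: (can_inj of_realK).
by rewrite of_realM !of_real_rnorm normrZ.
Qed.

Lemma rnorm_scaler (V : normedModType K) (x : V) (r : R) : 0 <= r ->
  rnorm (of_real s r *: x) = r * rnorm x.
Proof.
move=> r0; rewrite rnormZ ger0_norm ?of_realK//.
by rewrite -of_real0 of_real_le.
Qed.

Lemma homogeneousE (V : lmodType K) (N : V -> R) :
  (forall x, 0 <= N x) ->
  (forall a x, N (a *: x) <= real_part `|a| * N x) ->
  forall (a : K) (x : V), N (a *: x) = real_part `|a| * N x.
Proof.
move=> N0 NZ a x; have [->|a0] := eqVneq a 0.
  apply/le_anti; rewrite NZ normr0.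
  by rewrite -[X in real_part X]of_real0 of_realK mul0r N0.
apply/le_anti; rewrite NZ /=.
have a_gt0 : 0 < real_part `|a|.
  rewrite lt_neqAle real_part_ge0// andbT eq_sym; apply: contra_neq a0 => a0.
  by apply/normr0_eq0; rewrite -(real_partK (normr_ge0 a)) a0 of_real0.
rewrite -ler_pdivlMl//.
have -> : (real_part `|a|)^-1 = real_part `|a^-1| :> R.
  apply: (can_inj of_realK); rewrite real_partK// normfV.
  apply: (mulfI (_ : `|a| != 0)); first by rewrite normr_eq0.
  rewrite divff ?normr_eq0//.
  by rewrite -{1}(real_partK (normr_ge0 a)) -of_realM divff ?of_real1// gt_eqF.
by rewrite -{1}(scalerK a0 x) NZ.
Qed.

End scalar_lemmas.

Lemma sup_le_ub_ge0 (R : realType) (A : set R) (M : R) :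
  0 <= M -> ubound A M -> sup A <= M.
Proof.
move=> M0 AM; have [->|/set0P A0] := eqVneq A set0; first by rewrite sup0.
exact: sup_le_ub.
Qed.

Lemma sup_set_ge0 (R : realType) (A : set R) :
  (forall a, A a -> 0 <= a) -> 0 <= sup A.
Proof.
move=> A0; have [supA|] := pselect (has_sup A); last by move/sup_out => ->.
have [a Aa] := supA.1; apply: (le_trans (A0 _ Aa)).
exact: sup_upper_bound.
Qed.

Section bounded_operators.
Context {R : realType} {s : scalars}.
Local Notation K := (scalar_field R s).
Variables X Y : normedModType K.

Definition is_bounded_operator (f : X -> Y) : bool :=
  `[< linear f /\ continuous f >].

(* Bounded linear maps are encoded as continuous linear maps. *)
Record bounded_operator := BoundedOperator {
  bounded_operator_fun :> X -> Y ;
  bounded_operatorP : is_bounded_operator bounded_operator_fun }.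

HB.instance Definition _ := [isSub for bounded_operator_fun].
HB.instance Definition _ := [Choice of bounded_operator by <:].

Lemma is_bounded_operator_submod : subsemimod_closed is_bounded_operator.
Proof.
split; first split.
- apply/asboolP; split; first by move=> a x y /=; rewrite scaler0 addr0.
  exact: cst_continuous.
- move=> f g /asboolP[fl fc] /asboolP[gl gc]; apply/asboolP; split.
    move=> a x y; rewrite /= !fctE fl gl scalerDr.
    by rewrite addrACA.
  by move=> x; apply: continuousD; [exact: fc|exact: gc].
- move=> a f /asboolP[fl fc]; apply/asboolP; split.
    move=> b x y; rewrite /= !fctE fl scalerDr !scalerA.
    by rewrite mulrC.
  by move=> x; apply: continuousZr; exact: fc.
Qed.

HB.instance Definition _ :=
  GRing.isSubmodClosed.Build K (X -> Y) is_bounded_operator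
    is_bounded_operator_submod.

HB.instance Definition _ :=
  [SubChoice_isSubLmodule of bounded_operator by <:].

Lemma bounded_operator_linear (T : bounded_operator) : linear T.
Proof. by have /asboolP[] := bounded_operatorP T. Qed.

HB.instance Definition _ (T : bounded_operator) :=
  GRing.isLinear.Build K X Y _ T (bounded_operator_linear T).

Lemma bounded_operator_continuous (T : bounded_operator) : continuous T.
Proof. by have /asboolP[] := bounded_operatorP T. Qed.

Definition operator_norm (T : bounded_operator) : R :=
  sup [set rnorm (T x) | x in [set x | `|x| <= 1]].

Lemma operator_norm_has_ubound (T : bounded_operator) :
  has_ubound [set rnorm (T x) | x in [set x | `|x| <= 1]].
Proof.
have /linear_bounded_continuous/bounded_funP/(_ 1)[M TM] :=
  @bounded_operator_continuous T.
exists (real_part M) => _ [x /= x1 <-]; apply: le_real_part; exact: TM.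
Qed.

Lemma operator_norm_ge0 (T : bounded_operator) : 0 <= operator_norm T.
Proof. by apply: sup_set_ge0 => _ [x _ <-]; exact: rnorm_ge0. Qed.

Lemma operator_norm_ub (T : bounded_operator) (x : X) :
  rnorm (T x) <= operator_norm T * rnorm x.
Proof.
have [->|x0] := eqVneq x 0; first by rewrite linear0 !rnorm0 mulr0.
have rx0 : 0 < rnorm x.
  by rewrite lt_neqAle rnorm_ge0 andbT eq_sym; apply: contra_neq x0; exact: rnorm_eq0.
rewrite -ler_pdivrMr// mulrC -rnorm_scaler ?invr_ge0 ?rnorm_ge0//.
rewrite -linearZ; apply: ub_le_sup; first exact: operator_norm_has_ubound.
exists (of_real s (rnorm x)^-1 *: x) => //=.
rewrite -of_real_rnorm -[leRHS]of_real1 of_real_le.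
by rewrite rnorm_scaler ?invr_ge0 ?rnorm_ge0// mulVf// gt_eqF.
Qed.

Lemma operator_norm_le (T : bounded_operator) (M : R) : 0 <= M ->
  (forall x, rnorm (T x) <= M * rnorm x) -> operator_norm T <= M.
Proof.
move=> M0 TM; apply: sup_le_ub_ge0 => // _ [x /= x1 <-].
apply: (le_trans (TM x)); rewrite -[leRHS]mulr1 ler_wpM2l//.
by rewrite -(@of_real_le R s) of_real_rnorm of_real1.
Qed.

Let norm T := of_real s (operator_norm T).

Let ler_normD T U : norm (T + U) <= norm T + norm U.
Proof.
rewrite -of_realD of_real_le; apply: operator_norm_le.
  by rewrite addr_ge0 ?operator_norm_ge0.
move=> x; apply: (le_trans (ler_rnormD _ _)).
by rewrite mulrDl lerD ?operator_norm_ub.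
Qed.

Let operator_normZ_le (a : K) T :
  operator_norm (a *: T) <= real_part `|a| * operator_norm T.
Proof.
apply: operator_norm_le; first by rewrite mulr_ge0 ?real_part_ge0 ?operator_norm_ge0.
move=> x; rewrite rnormZ -mulrA ler_wpM2l ?real_part_ge0//.
exact: operator_norm_ub.
Qed.

Let normrZ (a : K) T : norm (a *: T) = `|a| * norm T.
Proof.
rewrite /norm (homogeneousE operator_norm_ge0 operator_normZ_le).
by rewrite of_realM real_partK.
Qed.

Let normr0_eq0 T : norm T = 0 -> T = 0.
Proof.
rewrite /norm -[RHS](@of_real0 R s) => /(can_inj (@of_realK R s)) T0.
apply/val_inj/funext => x; apply: rnorm_eq0; apply/le_anti.
by rewrite rnorm_ge0 andbT (le_trans (operator_norm_ub T x))// T0 mul0r.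
Qed.

HB.instance Definition _ :=
  Lmodule_isNormed.Build K bounded_operator ler_normD normrZ normr0_eq0.

End bounded_operators.

Notation operators X := (bounded_operator X X).
Notation dual X := (bounded_operator X (scalar_field _ _)^o).

Section numerical_index.
Context {R : realType} {s : scalars}.
Local Notation K := (scalar_field R s).
Variable X : normedModType K.

Definition state_pairs : set (dual X * X) :=
  [set p : dual X * X | [/\ `|p.1| = 1, `|p.2| = 1 & p.1 p.2 = 1]].

Definition numerical_radius (T : operators X) : R :=
  sup [set rnorm (p.1 (T p.2)) | p in state_pairs].

Definition numerical_index : R :=
  inf [set numerical_radius T | T in [set T : operators X | `|T| = 1]].

Definition compact_operator (T : operators X) : Prop :=
  precompact (T @` [set x | `|x| <= 1]).

Lemma numerical_radius_has_ubound (T : operators X) :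
  has_ubound [set rnorm (p.1 (T p.2)) | p in state_pairs].
Proof.
exists (operator_norm T) => _ [[f x] /= [f1 x1 _] <-].
apply: (le_trans (operator_norm_ub f (T x))).
have -> : operator_norm f = 1.
  by apply: (can_inj (@of_realK R s)); rewrite of_real1 -[RHS]f1.
rewrite mul1r (le_trans (operator_norm_ub T x))//.
have -> : rnorm x = 1.
  by apply: (can_inj (@of_realK R s)); rewrite of_real1 -[RHS]x1 of_real_rnorm.
by rewrite mulr1.
Qed.

Lemma numerical_radius_ge0 (T : operators X) : 0 <= numerical_radius T.
Proof. by apply: sup_set_ge0 => _ [p _ <-]; exact: rnorm_ge0. Qed.

Lemma numerical_radius_ub (T : operators X) p : state_pairs p ->
  rnorm (p.1 (T p.2)) <= numerical_radius T.
Proof.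
move=> Pp; apply: (ub_le_sup (numerical_radius_has_ubound T)).
by exists p.
Qed.

Lemma numerical_radiusD (T U : operators X) :
  numerical_radius (T + U) <= numerical_radius T + numerical_radius U.
Proof.
apply: sup_le_ub_ge0; first by rewrite addr_ge0 ?numerical_radius_ge0.
move=> _ [p Pp <-]; rewrite [(T + U) _]/(T p.2 + U p.2) linearD.
by rewrite (le_trans (ler_rnormD _ _))// lerD ?numerical_radius_ub.
Qed.

Lemma numerical_radiusZ_le (a : K) (T : operators X) :
  numerical_radius (a *: T) <= real_part `|a| * numerical_radius T.
Proof.
apply: sup_le_ub_ge0.
  by rewrite mulr_ge0 ?real_part_ge0 ?numerical_radius_ge0.
move=> _ [p Pp <-]; rewrite [(a *: T) _]/(a *: T p.2) linearZ rnormZ.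
by rewrite ler_wpM2l ?real_part_ge0 ?numerical_radius_ub.
Qed.

Lemma numerical_radiusZ (a : K) (T : operators X) :
  numerical_radius (a *: T) = real_part `|a| * numerical_radius T.
Proof. exact: homogeneousE numerical_radius_ge0 numerical_radiusZ_le a T. Qed.

Lemma numerical_index_le (T : operators X) :
  numerical_index * rnorm T <= numerical_radius T.
Proof.
have [->|T0] := eqVneq T 0; first by rewrite rnorm0 mulr0 numerical_radius_ge0.
have T_gt0 : 0 < rnorm T.
  rewrite lt_neqAle rnorm_ge0 andbT eq_sym; apply: contra_neq T0.
  exact: rnorm_eq0.
have Ti0 : 0 <= (rnorm T)^-1 by rewrite invr_ge0 ltW.
have -> : numerical_radius T =
    numerical_radius (of_real s (rnorm T)^-1 *: T) * rnorm T.
  rewrite numerical_radiusZ ger0_norm ?of_realK.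
    by rewrite mulrAC mulVf ?mul1r// gt_eqF.
  by rewrite -of_real0 of_real_le.
rewrite ler_pM2r//; apply: ge_inf.
  by exists 0 => _ [U _ <-]; exact: numerical_radius_ge0.
exists (of_real s (rnorm T)^-1 *: T) => //=.
by rewrite -of_real_rnorm rnorm_scaler// mulVf ?of_real1// gt_eqF.
Qed.

Definition infinite_dimensional : Prop :=
  ~ exists (n : nat) (b : 'I_n -> X), forall x, exists c : 'I_n -> K,
      x = \sum_(i < n) c i *: b i.

End numerical_index.
Arguments state_pairs {R s} X.

(* L(X) renormed by the numerical radius, which is a norm as n(X) > 0. *)
Definition operators_v (R : realType) (s : scalars)
    (X : normedModType (scalar_field R s)) (nX : 0 < numerical_index X) : Type :=
  operators X.

Section operators_v.
Context {R : realType} {s : scalars}.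
Local Notation K := (scalar_field R s).
Variables (X : normedModType K) (nX : 0 < numerical_index X).

HB.instance Definition _ := GRing.Lmodule.copy (operators_v nX) (operators X).

Let norm (T : operators_v nX) : K := of_real s (numerical_radius T).

Let ler_normD T U : norm (T + U) <= norm T + norm U.
Proof. by rewrite -of_realD of_real_le numerical_radiusD. Qed.

Let normrZ (a : K) T : norm (a *: T) = `|a| * norm T.
Proof. by rewrite /norm numerical_radiusZ of_realM real_partK. Qed.

Let normr0_eq0 T : norm T = 0 -> T = 0.
Proof.
rewrite /norm -[RHS](@of_real0 R s) => /(can_inj (@of_realK R s)) T0.
apply: (@rnorm_eq0 R s (operators X)); apply/le_anti; rewrite rnorm_ge0 andbT.
by rewrite -(pmulr_rle0 _ nX) -T0 numerical_index_le.
Qed.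

HB.instance Definition _ :=
  Lmodule_isNormed.Build K (operators_v nX) ler_normD normrZ normr0_eq0.

Definition compact_operators_v : set (operators_v nX) :=
  [set T | compact_operator (T : operators X)].

End operators_v.
Arguments compact_operators_v {R s X} nX.

Section M_ideals.
Context {R : realType} {s : scalars}.
Local Notation K := (scalar_field R s).
Variable Z : normedModType K.

Definition annihilator (J : set Z) : set (dual Z) :=
  [set f | forall z, J z -> f z = 0].

Definition M_ideal (J : set Z) : Prop :=
  [/\ GRing.submod_closed (fun z => z \in J),
      closed J &
      exists P : {linear dual Z -> dual Z},
        [/\ forall f, P (P f) = P f,
            [set f | P f = 0] = annihilator J &
            forall f, `|f| = `|P f| + `|f - P f|]].

End M_ideals.

Record directed_preorder (D : Type) (le : D -> D -> Prop) : Prop := {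
  directed_inhabited : inhabited D ;
  directed_refl : forall a, le a a ;
  directed_trans : forall a b c, le a b -> le b c -> le a c ;
  directed_upper : forall a b, exists c, le a c /\ le b c }.

Section nets.
Context {D : Type}.
Variable le : D -> D -> Prop.

Definition net_tail (a : D) : set D := [set b | le a b].

Definition net_filter : set_system D := filter_from setT net_tail.

Definition net_limsup (R : realType) (r : D -> R) : \bar R :=
  ereal_inf [set ereal_sup [set (r b)%:E | b in net_tail a] | a in setT].

Context {R : realType} {s : scalars}.
Variable X : normedModType (scalar_field R s).

Definition weakly_null (x_ : D -> X) : Prop :=
  forall f : dual X, f (x_ b) @[b --> net_filter] --> (0 : (scalar_field R s)^o).

Definition weak_star_null (f_ : D -> dual X) : Prop :=
  forall x : X, f_ b x @[b --> net_filter] --> (0 : (scalar_field R s)^o).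

End nets.

(* Main.v *)
From HB Require Import structures.
Require Import Defs.
From mathcomp Require Import all_boot all_order all_algebra.
From mathcomp Require Import all_classical all_reals all_analysis.
From mathcomp.real_closed Require Import complex.
From mathcomp Require Import ring lra.

Import Order.TTheory GRing.Theory Num.Theory.
Import numFieldNormedType.Exports.

(** Let [v] be the numerical radius, [n] the numerical index, [C] a constant
    depending on [n] only, and let [P] be the L-projection on the dual of the
    space of operators whose kernel is the annihilator of the compact ones.

    Fix [g] in the dual of [X].  If [S] is compact and [v S <= 1], then for
    every functional [f] on operators one has
    [f (S + 1) - (P f) 1 = (P f) S + (f - P f) 1], which is at most [`|f|]; a
    Hahn-Banach argument ([Helly_selection]) turns this into compact operators
    [T] with [v (S + 1 - T) <= 1 + e] along which [g \o T] converges weak-star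
    to the functional [E g : x2 |-> (P w) 1], where [w A = x2 (g \o A)]
    ([M_ideal_approximation]).  Suppose that [E g = g].  For a weak-star null
    family [f_b], compact operators make [f_b] tend to [0], so that the
    transpose of [S + 1 - T] sends [g + f_b] to about [g \o S + f_b].
    Since [n * `|S + 1 - T| <= v (S + 1 - T)], and since [g \o S] comes close
    to any functional [f] with [`|f| <= `|g|], this would prove (2).

    However [E g] lives in the third dual and need not be [g] for any obvious
    reason: the uniqueness of norm preserving extensions only says that
    [g - E g] is numerically null, and over the reals the dual of [X] may have
    nonzero numerically null operators although [n > 0].  The argument is
    therefore completed by two facts.

    First, [E g] belongs to the dual of [X] ([E_canonical]).  For
    [v A <= 1 + e] the operators [(1 - t) + t A] and [(1 - t) - t A] have norm
    at most [1 + C t^2 + O(e)] ([radius_growth]).  Applied to [S + 1 - T] with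
    [S] of rank one, this yields [relaxation_inequality]: the step
    [psi |-> psi - t E (psi restricted to X)] in the third dual decreases the
    norm of [psi] by [t] times the norm of its restriction, up to [O(t^2)].
    As the restriction itself shrinks no faster, the excess of [`|psi|] over
    the norm of the restriction does not grow.  Starting at [g], where the
    excess is [0], iteration makes both small (formally, an almost minimizer of
    a combination of the two is used, see [E_dense_range]); as the steps only
    subtract values of [E], [g] is in the closure of the range of [E].  Since
    [E] is bounded below, even after restriction, its values are canonical.

    Second, [q = 1 - E] is skew: [1 + t q] and [1 - t q] are isometric up to
    [C t^2] ([skew_defect]).  Hence the iterates [y_k] of [1 + t q] at [g] keep
    the norm of [g] and the bound on [limsup `|g + f_b|], while the argument
    above, applied at [y_k], bounds [limsup `|f + q y_k + f_b|].  The sum of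
    the [q y_k] telescopes to [(y_m - g) / t], so averaging over [k] removes
    [q] and proves (2) ([weak_star_null_limsup_le]).

    Finally (1) follows from (2) by duality ([weakly_null_limsup_le]): norming
    functionals of [x + x_b] are, along an ultrafilter, a weak-star null
    perturbation of their weak-star limit. *)

Set Implicit Arguments.
Unset Strict Implicit.
Unset Printing Implicit Defensive.

Local Open Scope classical_set_scope.
Local Open Scope ring_scope.

(** * Real and complex scalars *)

Section Scalars.
Context {R : realType} {s : scalars}.
Local Notation K := (scalar_field R s).

Lemma of_realN (x : R) : of_real s (- x) = - of_real s x.
Proof. by case: s => //=; rewrite rmorphN. Qed.

Lemma of_realB (x y : R) : of_real s (x - y) = of_real s x - of_real s y.
Proof. by rewrite of_realD of_realN. Qed.

Lemma real_part_mulr (r : R) (z : K) :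
  real_part (of_real s r * z) = r * real_part z.
Proof. by case: s z => //= -[a b] /=; rewrite mul0r subr0. Qed.

Lemma real_part0 : real_part (0 : K) = 0.
Proof. by rewrite -[X in real_part X]of_real0 of_realK. Qed.

Lemma real_partN (z : K) : real_part (- z) = - real_part z.
Proof. by case: s z => //= -[]. Qed.

Lemma real_partB (z t : K) : real_part (z - t) = real_part z - real_part t.
Proof. by rewrite real_partD real_partN. Qed.

Lemma real_part_le_norm (z : K) : real_part z <= real_part `|z|.
Proof.
case: s z => /=; first by move=> z; exact: ler_norm.
move=> z; apply: le_trans (ler_norm _) _.
by have := @le_real_part R ComplexScalars _ _ (normc_ge_Re z).
Qed.

Lemma exists_phase (z : K) : exists2 a : K, `|a| = 1 & a * z = `|z|.
Proof.
have [->|z0] := eqVneq z 0; first by exists 1; rewrite ?normr1 ?mulr0 ?normr0.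
exists (`|z| / z); last by rewrite mulfVK.
by rewrite normrM normr_id normfV divff// normr_eq0.
Qed.

Lemma norm_of_real (r : R) : `|of_real s r| = of_real s `|r|.
Proof.
have [r0|r0] := leP 0 r.
  by rewrite !ger0_norm// -of_real0 of_real_le.
rewrite [`|r|]ltr0_norm// of_realN ler0_norm//.
by rewrite -of_real0 of_real_le ltW.
Qed.

(** Over the reals this is [0], so that the formulas recovering a scalar or a
    functional from its real part hold for both fields. *)
Definition imaginary_unit : K :=
  match s return scalar_field R s with
  | RealScalars => 0
  | ComplexScalars => ('i)%C
  end.

Lemma scalar_reconstruct (z : K) :
  z = of_real s (real_part z)
      - imaginary_unit * of_real s (real_part (imaginary_unit * z)).
Proof.
rewrite /imaginary_unit; case: s z => /= [z|[a b]]; first by rewrite !mul0r subr0.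
by simpc.
Qed.

Lemma real_part_normal_form (a b : R) :
  real_part (of_real s a - imaginary_unit * of_real s b) = a.
Proof. by rewrite /imaginary_unit; case: s => /=; rewrite ?mul0r ?subr0//; simpc. Qed.

Lemma imaginary_unit_cases :
  (imaginary_unit = 0 :> K) \/ (imaginary_unit * imaginary_unit = -1 :> K).
Proof.
rewrite /imaginary_unit; case: s => /=; [by left|right].
by rewrite -expr2 sqr_i.
Qed.

End Scalars.

Section NormLemmas.
Context {R : realType} {s : scalars}.
Local Notation K := (scalar_field R s).
Variable V : normedModType K.
Implicit Types x y : V.

Lemma rnormN x : rnorm (- x) = rnorm x.
Proof. by rewrite /rnorm normrN. Qed.

Lemma rnorm_distC x y : rnorm (x - y) = rnorm (y - x).
Proof. by rewrite /rnorm distrC. Qed.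

Lemma ler_rnormB x y : rnorm (x - y) <= rnorm x + rnorm y.
Proof. by rewrite (le_trans (ler_rnormD _ _))// rnormN. Qed.

Lemma rnorm_unimodular (a : K) x : `|a| = 1 -> rnorm (a *: x) = rnorm x.
Proof. by move=> a1; rewrite rnormZ a1 -(@of_real1 R s) of_realK mul1r. Qed.

Lemma rnormZr (r : R) x : rnorm (of_real s r *: x) = `|r| * rnorm x.
Proof. by rewrite rnormZ norm_of_real of_realK. Qed.

Lemma rnorm_le x y : (rnorm x <= rnorm y) = (`|x| <= `|y|).
Proof. by rewrite -!of_real_rnorm of_real_le. Qed.

Lemma rnorm_triangle x y : rnorm x <= rnorm y + rnorm (x - y).
Proof. by rewrite -{1}[x](subrK y) addrC (le_trans (ler_rnormD _ _))// addrC. Qed.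

Lemma rnorm_gt0 x : x != 0 -> 0 < rnorm x.
Proof.
move=> x0; rewrite lt_neqAle rnorm_ge0 andbT eq_sym.
by apply: contra_neq x0; exact: rnorm_eq0.
Qed.

End NormLemmas.

Section OperatorOfBound.
Context {R : realType} {s : scalars}.
Local Notation K := (scalar_field R s).
Variables (V W : normedModType K) (f : V -> W) (lf : linear f) (M : R).
Hypothesis fM : forall x, rnorm (f x) <= M * rnorm x.

Lemma bounded_linear_is_operator : is_bounded_operator f.
Proof.
apply/asboolP; split=> //.
pose fl := GRing.isLinear.Build K V W _ f lf.
pose F : {linear V -> W} := HB.pack f fl.
apply: (@bounded_linear_continuous _ _ _ F).
apply/linear_boundedP; near=> N => x.
rewrite -!of_real_rnorm; apply: (@le_trans _ _ (of_real s (Num.max M 0 * rnorm x))).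
  rewrite of_real_le (le_trans (fM x))// ler_wpM2r ?rnorm_ge0//.
  by rewrite le_max lexx.
rewrite of_realM ler_wpM2r// -?of_real0 ?of_real_le ?rnorm_ge0//.
near: N; apply: nbhs_pinfty_ge.
by rewrite realE -of_real0 of_real_le le_max lexx orbT.
Unshelve. all: by end_near. Qed.

Definition operator_of_bound : bounded_operator V W :=
  BoundedOperator bounded_linear_is_operator.

Lemma rnorm_operator_of_bound : 0 <= M -> rnorm operator_of_bound <= M.
Proof. by move=> M0; rewrite /rnorm of_realK; exact: operator_norm_le. Qed.

End OperatorOfBound.

(** * Bounded operators, adjoints and canonical embeddings *)

Section Operators.
Context {R : realType} {s : scalars}.
Local Notation K := (scalar_field R s).
Implicit Types V W Y : normedModType K.

Lemma opD V W (T U : bounded_operator V W) x : (T + U) x = T x + U x.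
Proof. by []. Qed.

Lemma opB V W (T U : bounded_operator V W) x : (T - U) x = T x - U x.
Proof. by []. Qed.

Lemma opZ V W (a : K) (T : bounded_operator V W) x : (a *: T) x = a *: T x.
Proof. by []. Qed.

Lemma map_opZ V W (T : bounded_operator V W) (a : K) x : T (a *: x) = a *: T x.
Proof. by rewrite [LHS]linearZ. Qed.

Lemma map_opD V W (T : bounded_operator V W) x y : T (x + y) = T x + T y.
Proof. by rewrite [LHS]linearD. Qed.

Lemma map_opB V W (T : bounded_operator V W) x y : T (x - y) = T x - T y.
Proof. by rewrite [LHS]linearB. Qed.

Lemma map_opN V W (T : bounded_operator V W) x : T (- x) = - T x.
Proof. by rewrite [LHS]linearN. Qed.

Lemma map_op0 V W (T : bounded_operator V W) : T 0 = 0.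
Proof. by rewrite [LHS]linear0. Qed.

Lemma op_ext V W (T U : bounded_operator V W) : T =1 U -> T = U.
Proof. by move=> TU; apply/val_inj/funext. Qed.

Lemma rnorm_opE V W (T : bounded_operator V W) : rnorm T = operator_norm T.
Proof. by rewrite /rnorm of_realK. Qed.

Lemma rnorm_op_ub V W (T : bounded_operator V W) x :
  rnorm (T x) <= rnorm T * rnorm x.
Proof. by rewrite rnorm_opE operator_norm_ub. Qed.

Lemma rnorm_op_le V W (T : bounded_operator V W) M : 0 <= M ->
  (forall x, rnorm (T x) <= M * rnorm x) -> rnorm T <= M.
Proof. by rewrite rnorm_opE; exact: operator_norm_le. Qed.

Lemma linear_id V : linear (@id V).
Proof. by []. Qed.

Lemma rnorm_id_bound V (x : V) : rnorm (id x) <= 1 * rnorm x.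
Proof. by rewrite mul1r. Qed.

Definition op_id V : operators V :=
  operator_of_bound (@linear_id V) (@rnorm_id_bound V).

Section composition.
Variables (V W Y : normedModType K).
Variables (g : bounded_operator W Y) (f : bounded_operator V W).

Lemma op_comp_linear : linear (g \o f).
Proof. by move=> a x y; rewrite /= !linearP. Qed.

Lemma op_comp_bound x : rnorm ((g \o f) x) <= (rnorm g * rnorm f) * rnorm x.
Proof.
rewrite -mulrA (le_trans (rnorm_op_ub _ _))// ler_wpM2l ?rnorm_ge0//.
exact: rnorm_op_ub.
Qed.

Definition op_comp : bounded_operator V Y :=
  operator_of_bound op_comp_linear op_comp_bound.

Lemma rnorm_op_comp : rnorm op_comp <= rnorm g * rnorm f.
Proof. by apply: rnorm_operator_of_bound; rewrite mulr_ge0 ?rnorm_ge0. Qed.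

Lemma op_compE x : op_comp x = g (f x).
Proof. by []. Qed.

End composition.

Section adjoint.
Variables (V W Y : normedModType K) (T : bounded_operator V W).

Lemma adjoint_linear : linear (fun g : bounded_operator W Y => op_comp g T).
Proof. by move=> a f g; apply: op_ext. Qed.

Lemma adjoint_bound (g : bounded_operator W Y) :
  rnorm (op_comp g T) <= rnorm T * rnorm g.
Proof. by rewrite mulrC rnorm_op_comp. Qed.

Definition adjoint : bounded_operator (bounded_operator W Y) (bounded_operator V Y) :=
  operator_of_bound adjoint_linear adjoint_bound.

Lemma rnorm_adjoint : rnorm adjoint <= rnorm T.
Proof. by apply: rnorm_operator_of_bound; rewrite ?rnorm_ge0. Qed.

End adjoint.

Section evaluation.
Variable V : normedModType K.

Lemma evaluation_at_linear (x : V) : linear (fun f : dual V => f x).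
Proof. by []. Qed.

Lemma evaluation_at_bound (x : V) (f : dual V) :
  rnorm (f x) <= rnorm x * rnorm f.
Proof. by rewrite mulrC rnorm_op_ub. Qed.

Definition evaluation_at (x : V) : dual (dual V) :=
  operator_of_bound (evaluation_at_linear x) (evaluation_at_bound x).

Lemma evaluation_linear : linear evaluation_at.
Proof.
move=> a x y; apply: op_ext => f.
exact: (@bounded_operator_linear _ _ _ _ f).
Qed.

Lemma evaluation_bound (x : V) : rnorm (evaluation_at x) <= 1 * rnorm x.
Proof. by rewrite mul1r; apply: rnorm_operator_of_bound; exact: rnorm_ge0. Qed.

Definition evaluation : bounded_operator V (dual (dual V)) :=
  operator_of_bound evaluation_linear evaluation_bound.

Lemma evaluationE x f : evaluation x f = f x.
Proof. by []. Qed.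

Lemma rnorm_evaluation x : rnorm (evaluation x) <= rnorm x.
Proof. by rewrite -[leRHS]mul1r; exact: evaluation_bound. Qed.

End evaluation.

Section rank_one.
Variables (V W : normedModType K) (f : dual V) (u : W).

Lemma rank_one_linear : linear (fun x => (f x : K) *: u).
Proof. by move=> a x y; rewrite linearP scalerDl scalerA. Qed.

Lemma rank_one_bound x : rnorm ((f x : K) *: u) <= (rnorm f * rnorm u) * rnorm x.
Proof.
by rewrite rnormZ mulrAC ler_wpM2r ?rnorm_ge0//; exact: rnorm_op_ub.
Qed.

Definition rank_one : bounded_operator V W :=
  operator_of_bound rank_one_linear rank_one_bound.

Lemma rnorm_rank_one : rnorm rank_one <= rnorm f * rnorm u.
Proof. by apply: rnorm_operator_of_bound; rewrite mulr_ge0 ?rnorm_ge0. Qed.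

End rank_one.

End Operators.
Arguments op_id {R s} V.
Arguments evaluation {R s} V.

Section Complexification.
Context {R : realType} {s : scalars}.
Local Notation K := (scalar_field R s).
Local Notation I := (@imaginary_unit R s).
Variable V : normedModType K.

(** The functional is [x |-> l x - i l (i x)]; rotating [x] so that its value
    becomes real shows that no norm is lost.  This reduces Hahn-Banach
    extensions and weak-star limits to real-valued functions. *)
Lemma complexify (l : V -> R) (M : R) : 0 <= M ->
  (forall x y, l (x + y) = l x + l y) ->
  (forall r x, l (of_real s r *: x) = r * l x) ->
  (forall x, l x <= M * rnorm x) ->
  exists2 f : dual V, forall x, real_part (f x) = l x & rnorm f <= M.
Proof.
move=> M0 lD lZ lM.
have lN x : l (- x) = - l x.
  by rewrite -[- x]scaleN1r -(of_real1 (s := s)) -of_realN lZ mulN1r.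
have swap (a b : K) (x : V) : a *: (b *: x) = b *: (a *: x).
  by rewrite !scalerA mulrC.
pose f (x : V) : K^o := of_real s (l x) - I * of_real s (l (I *: x)).
have fre x : real_part (f x) = l x by rewrite real_part_normal_form.
have fD x y : f (x + y) = f x + f y.
  by rewrite /f scalerDr !lD !of_realD; ring.
have fr (r : R) x : f (of_real s r *: x) = of_real s r * f x.
  by rewrite /f swap !lZ !of_realM; ring.
have fI x : f (I *: x) = I * f x.
  rewrite /f; have [->|I2] := imaginary_unit_cases (R := R) (s := s).
    by rewrite !scale0r !mul0r; have := lZ 0 0; rewrite mul0r scaler0 => ->; rewrite of_real0 subr0.
  have II (z : K) : I * (I * z) = - z by rewrite mulrA I2 mulN1r.
  by rewrite scalerA I2 scaleN1r lN of_realN mulrBr II mulrN !opprK addrC.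
have fB x y : f (x - y) = f x - f y.
  by rewrite fD -(scaleN1r y) -(of_real1 (s := s)) -of_realN fr of_realN of_real1 mulN1r.
have lf : linear f.
  move=> a x y; rewrite fD; congr (_ + _).
  rewrite [a in LHS]scalar_reconstruct scalerBl fB fr.
  rewrite -scalerA fI fr; transitivity ((of_real s (real_part a)
      - I * of_real s (real_part (I * a))) * f x); first by ring.
  by rewrite -scalar_reconstruct.
have fM x : rnorm (f x) <= M * rnorm x.
  have [a a1 af] := exists_phase (f x).
  rewrite /rnorm -af.
  have f0 : f 0 = 0 by have := fr 0 0; rewrite scaler0 of_real0 mul0r.
  have -> : a * f x = f (a *: x) by rewrite -[a *: x]addr0 lf f0 addr0.
  by rewrite fre (le_trans (lM _))// rnorm_unimodular.
exists (operator_of_bound lf fM); first exact: fre.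
exact: rnorm_operator_of_bound.
Qed.

Lemma functionalZ (f : dual V) (a : K) x : f (a *: x) = a * f x.
Proof. by rewrite linearZ. Qed.

Lemma real_part_dual_le (f : dual V) x :
  real_part (f x) <= rnorm f * rnorm x.
Proof. by rewrite (le_trans (real_part_le_norm _))// rnorm_op_ub. Qed.

Lemma rnorm_dual_le (f : dual V) M : 0 <= M ->
  (forall x, real_part (f x) <= M * rnorm x) -> rnorm f <= M.
Proof.
move=> M0 fM; apply: rnorm_op_le => // x.
have [a a1 af] := exists_phase (f x).
by rewrite /rnorm -af -functionalZ (le_trans (fM _))// rnorm_unimodular.
Qed.

(** The value at [x] is made real and nonnegative by rotating [x]. *)
Lemma almost_norming (f : dual V) (e : R) : 0 < e ->
  exists x r, [/\ rnorm x <= 1, f x = of_real s r, rnorm f - e <= r & 0 <= r].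
Proof.
move=> e0; have [f0|f0] := leP (rnorm f) e.
  exists 0, 0; rewrite rnorm0 linear0 of_real0.
  by split=> //; rewrite subr_le0.
apply: contrapT => nex.
suff : rnorm f <= rnorm f - e by rewrite lerBrDl gerDr leNgt e0.
apply: rnorm_dual_le => [|x]; first by rewrite subr_ge0 ltW.
have [->|x0] := eqVneq x 0; first by rewrite linear0 rnorm0 mulr0 real_part0.
rewrite leNgt; apply/negP => fx; apply: nex.
have [a a1 af] := exists_phase (f x).
have nx0 : rnorm x != 0 by rewrite gt_eqF ?rnorm_gt0.
have ix0 : 0 < (rnorm x)^-1 by rewrite invr_gt0 rnorm_gt0.
exists (of_real s (rnorm x)^-1 *: (a *: x)), ((rnorm x)^-1 * rnorm (f x)); split.
- by rewrite rnorm_scaler ?(ltW ix0)// rnorm_unimodular// mulVf.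
- by rewrite !functionalZ af -of_real_rnorm of_realM.
- rewrite ler_pdivlMl ?rnorm_gt0// mulrC ltW// (lt_le_trans fx)//.
  exact: real_part_le_norm.
- by rewrite mulr_ge0 ?rnorm_ge0// ltW.
Qed.

End Complexification.

(** * Hahn-Banach theorem and Helly's selection principle *)

Section HahnBanach.
Context {R : realType} {s : scalars}.
Local Notation K := (scalar_field R s).
Variable V : lmodType K.
Implicit Types (p q : V -> R) (x y a : V).

Definition sublinear p : Prop :=
  (forall x y, p (x + y) <= p x + p y) /\
  (forall t x, 0 < t -> p (of_real s t *: x) <= t * p x).

Lemma sublinear0 p : sublinear p -> p 0 = 0.
Proof.
move=> [pD pZ]; apply/le_anti/andP; split; last first.
  by have := pD 0 0; rewrite addr0; lra.
have := pZ (1 / 2) 0; rewrite scaler0 => /(_ _)/le_trans h.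
have : p 0 <= 1 / 2 * p 0 by apply: h; lra.
lra.
Qed.

Lemma sublinearZ p t x : sublinear p -> 0 <= t -> p (of_real s t *: x) = t * p x.
Proof.
move=> pS; rewrite le_eqVlt => /orP[/eqP <-|t0].
  by rewrite of_real0 scale0r mul0r sublinear0.
apply/le_anti/andP; split; first exact: pS.2.
have it0 : 0 < t^-1 by rewrite invr_gt0.
have := pS.2 t^-1 (of_real s t *: x) it0.
rewrite scalerA -of_realM mulVf ?gt_eqF// of_real1 scale1r.
by rewrite ler_pdivlMl.
Qed.

Lemma sublinear_ge p x : sublinear p -> - p (- x) <= p x.
Proof.
move=> pS; have := pS.1 x (- x); rewrite subrr sublinear0//; lra.
Qed.

(** The largest sublinear minorant of [q] whose value at [- a] is at most
    [- q a]. *)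
Definition tilt q a x : R :=
  inf [set q (x + of_real s t *: a) - t * q a | t in [set t | 0 <= t]].

Section tilt.
Variables (q : V -> R) (a : V).
Hypothesis qS : sublinear q.

Let tilt_lb x t : 0 <= t -> - q (- x) <= q (x + of_real s t *: a) - t * q a.
Proof.
move=> t0; rewrite -(sublinearZ a qS t0).
have := qS.1 (- x) (x + of_real s t *: a); rewrite addKr; lra.
Qed.

Lemma tilt_le x t : 0 <= t -> tilt q a x <= q (x + of_real s t *: a) - t * q a.
Proof.
move=> t0; apply: ge_inf; last by exists t.
by exists (- q (- x)) => _ [u u0 <-]; exact: tilt_lb.
Qed.

Lemma tilt_ge x c :
  (forall t, 0 <= t -> c <= q (x + of_real s t *: a) - t * q a) ->
  c <= tilt q a x.
Proof.
move=> cq; apply: lb_le_inf.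
  by exists (q (x + of_real s 0 *: a) - 0 * q a), 0 => //=.
by move=> _ [u u0 <-]; exact: cq.
Qed.

Lemma tilt_minor x : tilt q a x <= q x.
Proof.
by have := tilt_le x (lexx 0); rewrite of_real0 scale0r addr0 mul0r subr0.
Qed.

Lemma tilt_sublinear : sublinear (tilt q a).
Proof.
split=> [x y|t x t0].
  rewrite -lerBlDr; apply: tilt_ge => t t0; rewrite lerBlDr -lerBlDl.
  apply: tilt_ge => u u0; rewrite lerBlDl.
  apply: le_trans (tilt_le _ (addr_ge0 t0 u0)) _.
  rewrite of_realD scalerDl addrACA mulrDl.
  by have := qS.1 (x + of_real s t *: a) (y + of_real s u *: a); lra.
rewrite -ler_pdivrMl//; apply: tilt_ge => u u0; rewrite ler_pdivrMl//.
apply: le_trans (tilt_le _ (_ : 0 <= t * u)) _.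
  by rewrite mulr_ge0// ltW.
rewrite of_realM -scalerA -scalerDr (sublinearZ _ qS (ltW t0)).
by rewrite mulrBr mulrA.
Qed.

End tilt.

(** A minimal sublinear functional [q] is linear: it coincides with each of
    its tilts, which makes it additive. *)
Lemma sublinear_minorant_linear p : sublinear p ->
  exists2 l : V -> R, forall x, l x <= p x &
    (forall x y, l (x + y) = l x + l y) /\
    (forall t x, l (of_real s t *: x) = t * l x).
Proof.
move=> pS.
pose T := {q : V -> R | sublinear q /\ forall x, q x <= p x}.
pose t0 : T := exist _ p (conj pS (fun x => lexx (p x))).
pose below (q1 q2 : T) : bool := `[< forall x, sval q2 x <= sval q1 x >].
have [||A totA|[q [qS qp]] qmin] := @ZL_preorder T t0 below.
- by move=> q; apply/asboolP.
- by move=> q1 q2 q3 /asboolP h1 /asboolP h2; apply/asboolP => x; exact: le_trans (h1 x).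
- have [A0|/set0P[q0 Aq0]] := eqVneq A set0.
    by exists t0 => q; rewrite A0.
  pose m x := inf [set sval q x | q in A].
  have m_lb x : lbound [set sval q x | q in A] (- p (- x)).
    move=> _ [[q [qS qp]] _ <-] /=.
    by apply: le_trans (sublinear_ge x qS); rewrite lerN2.
  have m_le (q : T) x : A q -> m x <= sval q x.
    by move=> Aq; apply: ge_inf; [exists (- p (- x)); exact: m_lb|exists q].
  have m_ge c x : (forall q : T, A q -> c <= sval q x) -> c <= m x.
    move=> cq; apply: lb_le_inf; first by exists (sval q0 x), q0.
    by move=> _ [q Aq <-]; exact: cq.
  have mS : sublinear m.
    split=> [x y|t x tgt0].
      rewrite -lerBlDr; apply: (m_ge) => q1 Aq1; rewrite lerBlDr -lerBlDl.
      apply: (m_ge) => q2 Aq2; rewrite lerBlDl.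
      have [/asboolP h|/asboolP h] := totA _ _ Aq1 Aq2.
        apply: le_trans (m_le _ _ Aq2) _.
        by apply: le_trans ((svalP q2).1.1 x y) _; rewrite lerD2r h.
      apply: le_trans (m_le _ _ Aq1) _.
      by apply: le_trans ((svalP q1).1.1 x y) _; rewrite lerD2l h.
    rewrite -ler_pdivrMl//; apply: (m_ge) => q Aq; rewrite ler_pdivrMl//.
    by apply: le_trans (m_le _ _ Aq) _; apply: (svalP q).1.2.
  have mp x : m x <= p x by apply: le_trans (m_le _ x Aq0) _; exact: (svalP q0).2.
  exists (exist _ m (conj mS mp)) => q Aq.
  by apply/asboolP => x; exact: m_le.
have q_tilt a x : q x <= tilt q a x.
  have tS := tilt_sublinear a qS.
  have tp y : tilt q a y <= p y by apply: le_trans (tilt_minor a qS y) _; exact: qp.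
  have /qmin/asboolP : below (exist _ q (conj qS qp))
      (exist _ (tilt q a) (conj tS tp)).
    by apply/asboolP => y; exact: tilt_minor.
  by apply.
have qD x y : q (x + y) = q x + q y.
  apply/le_anti; rewrite qS.1/= -lerBrDr.
  apply: le_trans (q_tilt y x) _.
  by have := tilt_le y qS x ler01; rewrite of_real1 scale1r mul1r.
have qN x : q (- x) = - q x.
  by apply/eqP; rewrite -addr_eq0 -qD addNr sublinear0.
exists q => //; split=> // t x; have [tge0|tlt0] := leP 0 t.
  exact: sublinearZ.
rewrite -[t]opprK of_realN scaleNr qN sublinearZ ?mulNr//.
by rewrite oppr_ge0 ltW.
Qed.

(** Tilting [p] at [x0] forces every linear minorant to reach [p x0] at [x0]. *)
Theorem Hahn_Banach p x0 : sublinear p ->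
  exists l : V -> R, [/\ forall x, l x <= p x, p x0 <= l x0,
    (forall x y, l (x + y) = l x + l y) &
    (forall t x, l (of_real s t *: x) = t * l x)].
Proof.
move=> pS; have [l lp [lD lZ]] := sublinear_minorant_linear (tilt_sublinear x0 pS).
exists l; split=> // [x|].
  by apply: le_trans (lp x) _; exact: tilt_minor.
have := lp (- x0); have := lZ (-1) x0.
rewrite of_realN of_real1 scaleN1r mulN1r => -> h.
have := tilt_le x0 pS (- x0) ler01.
by rewrite of_real1 scale1r addNr sublinear0// mul1r; lra.
Qed.

End HahnBanach.

Section HellySelection.
Context {R : realType} {s : scalars}.
Local Notation K := (scalar_field R s).

Lemma eq_norm_of_real_part (z : K) : real_part `|z| <= real_part z -> z = `|z|.
Proof.
case: s z => /= [z|[a b]]; first by move=> h; apply/le_anti; rewrite h ler_norm.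
rewrite normc_def /= => h.
have a0 : 0 <= a by apply: le_trans h; exact: sqrtr_ge0.
have : a ^+ 2 + b ^+ 2 <= a ^+ 2.
  rewrite -(@sqr_sqrtr _ (a ^+ 2 + b ^+ 2)) ?addr_ge0 ?sqr_ge0//.
  by rewrite lerXn2r ?nnegrE ?sqrtr_ge0.
rewrite gerDl => b2; have /eqP : b ^+ 2 = 0 by apply/le_anti; rewrite b2 sqr_ge0.
by rewrite sqrf_eq0 => /eqP ->; rewrite expr0n /= addr0 sqrtr_sqr ger0_norm.
Qed.

Lemma rnorm_sublinear (V : normedModType K) : sublinear (s := s) (@rnorm R s V).
Proof.
split; first by move=> x y; exact: ler_rnormD.
by move=> t x t0; rewrite (rnorm_scaler _ (ltW t0)).
Qed.

Lemma exists_norming_functional (V : normedModType K) (x : V) :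
  exists2 f : dual V, rnorm f <= 1 & f x = of_real s (rnorm x).
Proof.
have [l [lN lx lD lZ]] := Hahn_Banach x (rnorm_sublinear V).
have [f fl f1] := complexify ler01 lD lZ (fun y => eq_ind_r (fun r => l y <= r) (lN y) (mul1r _)).
exists f => //.
have fx1 : real_part `|f x| <= rnorm x.
  apply: le_trans (rnorm_op_ub f x) _.
  by rewrite ler_piMl ?rnorm_ge0.
have fxE : f x = `|f x| by apply: eq_norm_of_real_part; rewrite fl (le_trans fx1).
rewrite fxE -[LHS]real_partK//; congr of_real; apply/le_anti.
by rewrite fx1 -fxE fl lx.
Qed.

Section selection.
Variables (Z W : normedModType K) (J : set Z) (Phi : bounded_operator Z W).
Variables (Theta : dual Z -> K) (z0 : Z) (w : W) (M : R).
Hypothesis M0 : 0 <= M.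
Hypothesis J_submod : GRing.submod_closed (fun z => z \in J).
Hypothesis ThetaD : forall f g, Theta (f + g) = Theta f + Theta g.
Hypothesis Theta_annihilator : forall f, annihilator J f -> Theta f = 0.
Hypothesis Theta_close : forall f : dual Z, real_part (f z0 - Theta f) <= M * rnorm f.
Hypothesis Theta_Phi : forall l : dual W, Theta (op_comp l Phi) = l w.

Let J0 : J 0. Proof. by have := J_submod.1; rewrite /in_mem /= in_setE. Qed.

Let JZD (a : K) u v : J u -> J v -> J (a *: u + v).
Proof.
move=> Ju Jv; have := J_submod.2 a u v.
by rewrite /in_mem /= !in_setE; apply.
Qed.

Let JD u v : J u -> J v -> J (u + v).
Proof. by move=> Ju Jv; rewrite -[u]scale1r; exact: JZD. Qed.

Let JZ (a : K) u : J u -> J (a *: u).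
Proof. by move=> Ju; rewrite -[a *: u]addr0; exact: JZD. Qed.

(** If no such [j] existed, the distance from [(z0, w)] to the graph of [Phi]
    over [J], for a suitable max norm on [Z * W], would be at least [1].  A
    functional [(f, g)] realizing this distance vanishes on the graph, hence
    [f + g \o Phi] annihilates [J], and [Theta f = - g w]; but then
    [f z0 - Theta f >= 1] while [`|f| <= (M + e)^-1].  With [Theta] evaluation
    at a point of the bidual this is Helly's theorem. *)
Lemma Helly_selection (e : R) : 0 < e ->
  exists j, [/\ J j, rnorm (z0 - j) <= M + e & rnorm (Phi j - w) <= e].
Proof.
move=> e0; apply: contrapT => nex.
have Me0 : 0 < M + e by rewrite ltr_wpDl.
pose a := (M + e)^-1; pose b := e^-1.
have a0 : 0 < a by rewrite invr_gt0.
have b0 : 0 < b by rewrite invr_gt0.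
pose m (j : Z) (x : Z * W) :=
  Num.max (a * rnorm (x.1 - j)) (b * rnorm (x.2 - Phi j)).
pose p (x : Z * W) := inf [set m j x | j in J].
have m_ge0 j x : 0 <= m j x by rewrite le_max mulr_ge0 ?rnorm_ge0// ltW.
have p_le x j : J j -> p x <= m j x.
  move=> Jj; apply: ge_inf; last by exists j.
  by exists 0 => _ [k _ <-].
have p_ge x c : (forall j, J j -> c <= m j x) -> c <= p x.
  move=> cm; apply: lb_le_inf; first by exists (m 0 x), 0.
  by move=> _ [k Jk <-]; exact: cm.
have pS : sublinear (s := s) p.
  split=> [x y|t x t0].
    rewrite -lerBlDr; apply: (p_ge) => j Jj; rewrite lerBlDr -lerBlDl.
    apply: (p_ge) => k Jk; rewrite lerBlDl.
    apply: le_trans (p_le _ _ (JD Jj Jk)) _.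
    rewrite /m ge_max; apply/andP; split.
      apply: (@le_trans _ _ (a * rnorm (x.1 - j) + a * rnorm (y.1 - k))).
        rewrite -mulrDr ler_pM2l//= opprD addrACA; exact: ler_rnormD.
      by rewrite lerD// le_max lexx.
    apply: (@le_trans _ _ (b * rnorm (x.2 - Phi j) + b * rnorm (y.2 - Phi k))).
      rewrite -mulrDr ler_pM2l//= linearD opprD addrACA; exact: ler_rnormD.
    by rewrite lerD// le_max lexx orbT.
  rewrite -ler_pdivrMl//; apply: (p_ge) => j Jj; rewrite ler_pdivrMl//.
  apply: le_trans (p_le _ _ (JZ (of_real s t) Jj)) _.
  have h1 : rnorm ((of_real s t *: x).1 - of_real s t *: j) = t * rnorm (x.1 - j).
    by rewrite -(rnorm_scaler _ (ltW t0)) scalerBr.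
  have h2 : rnorm ((of_real s t *: x).2 - Phi (of_real s t *: j)) =
      t * rnorm (x.2 - Phi j).
    by rewrite -(rnorm_scaler _ (ltW t0)) scalerBr [Phi _]linearZZ.
  rewrite /m h1 h2 maxr_pMr ?(ltW t0)//.
  by rewrite !(mulrCA t).
have [l [lp lx0 lD lZ]] := Hahn_Banach (z0, w) pS.
have p1 : 1 <= p (z0, w).
  apply: (p_ge) => j Jj; rewrite leNgt; apply/negP; rewrite gt_max /= => /andP[h1 h2].
  apply: nex; exists j; split=> //.
    by move: h1; rewrite -ltr_pdivlMl// invrK mulr1 => /ltW.
  by move: h2; rewrite -ltr_pdivlMl// invrK mulr1 rnorm_distC => /ltW.
have fD x y : l (x + y, 0) = l (x, 0) + l (y, 0).
  by rewrite -lD; congr l; congr pair; rewrite /= addr0.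
have fZ r x : l (of_real s r *: x, 0) = r * l (x, 0).
  by rewrite -lZ; congr l; congr pair; rewrite /= scaler0.
have fM x : l (x, 0) <= a * rnorm x.
  apply: le_trans (lp _) _; apply: le_trans (p_le _ _ J0) _.
  by rewrite /m /= [Phi 0]linear0 !subr0 rnorm0 mulr0 ge_max lexx ?andbT mulr_ge0 ?rnorm_ge0 ?(ltW a0) ?(ltW b0).
have gD x y : l (0, x + y) = l (0, x) + l (0, y).
  by rewrite -lD; congr l; congr pair; rewrite /= addr0.
have gZ r x : l (0, of_real s r *: x) = r * l (0, x).
  by rewrite -lZ; congr l; congr pair; rewrite /= scaler0.
have gM x : l (0, x) <= b * rnorm x.
  apply: le_trans (lp _) _; apply: le_trans (p_le _ _ J0) _.
  by rewrite /m /= [Phi 0]linear0 !subr0 rnorm0 mulr0 ge_max lexx ?andbT mulr_ge0 ?rnorm_ge0 ?(ltW a0) ?(ltW b0).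
have [f fE fa] := complexify (ltW a0) fD fZ fM.
have [g gE _] := complexify (ltW b0) gD gZ gM.
have lE z t : real_part (f z) + real_part (g t) = l (z, t).
  by rewrite fE gE -lD; congr l; congr pair; rewrite /= ?addr0 ?add0r.
have h_annihilator : annihilator J (f + op_comp g Phi).
  move=> j Jj; have [c c1 ch] := exists_phase ((f + op_comp g Phi) j).
  apply: (@rnorm_eq0 R s K^o); apply/le_anti; rewrite rnorm_ge0 andbT.
  rewrite /rnorm -ch -functionalZ opD real_partD op_compE lE.
  apply: le_trans (lp _) _; apply: le_trans (p_le _ _ (JZ c Jj)) _.
  by rewrite /m /= !subrr !rnorm0 !mulr0 maxxx.
have := Theta_annihilator h_annihilator; rewrite ThetaD Theta_Phi => /eqP.
rewrite addr_eq0 => /eqP ThetaE.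
have : 1 <= M * a.
  apply: (@le_trans _ _ (M * rnorm f)); last by rewrite ler_wpM2l.
  apply: le_trans (Theta_close f); rewrite ThetaE opprK real_partD lE.
  exact: le_trans lx0.
by rewrite -ler_pdivrMr// invrK mul1r; lra.
Qed.

End selection.

End HellySelection.

(** * Growth of operators controlled by the numerical radius *)

Section NumericalRadius.
Context {R : realType} {s : scalars}.
Local Notation K := (scalar_field R s).
Variable X : normedModType K.
Local Notation n := (numerical_index X).

Lemma op_idE (x : X) : op_id X x = x.
Proof. by []. Qed.

Lemma rnorm_eq1 (V : normedZmodType K) (x : V) : (`|x| = 1) <-> (rnorm x = 1).
Proof.
split=> [x1|x1]; first by rewrite /rnorm x1 -(of_real1 (s := s)) of_realK.
by rewrite -of_real_rnorm x1 of_real1.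
Qed.

Lemma numerical_radius_le (T : operators X) (M : R) : 0 <= M ->
  (forall (f : dual X) x, rnorm f = 1 -> rnorm x = 1 -> f x = 1 -> rnorm (f (T x)) <= M) ->
  numerical_radius T <= M.
Proof.
move=> M0 TM; apply: sup_le_ub_ge0 => // _ [[f x] /= [f1 x1 fx] <-].
by apply: TM => //; apply/rnorm_eq1.
Qed.

Lemma numerical_radius_le_norm (T : operators X) : numerical_radius T <= rnorm T.
Proof.
apply: numerical_radius_le => [|f x f1 x1 _]; first exact: rnorm_ge0.
apply: le_trans (rnorm_op_ub f (T x)) _; rewrite f1 mul1r.
by apply: le_trans (rnorm_op_ub T x) _; rewrite x1 mulr1.
Qed.

Lemma numerical_radius_id : numerical_radius (op_id X) <= 1.
Proof.
apply: numerical_radius_le => // f x _ _ fx.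
by rewrite op_idE fx /rnorm normr1 -(of_real1 (s := s)) of_realK.
Qed.

Lemma exists_state (x : X) : rnorm x = 1 ->
  exists f : dual X, state_pairs X (f, x).
Proof.
move=> x1; have [f f1 fx] := exists_norming_functional x.
rewrite x1 of_real1 in fx; exists f; split=> //=; last by apply/rnorm_eq1.
apply/rnorm_eq1/le_anti; rewrite f1 /=.
have := rnorm_op_ub f x; rewrite x1 mulr1 fx /rnorm normr1.
by rewrite -[X in real_part X](of_real1 (s := s)) of_realK.
Qed.

Section accretive.
Variables (D : operators X) (d : R).
Hypothesis D_accretive :
  forall p, state_pairs X p -> - d <= real_part (p.1 (D p.2)).

Lemma accretive_lower_bound (t : R) (x : X) : 0 <= t ->
  (1 - t * d) * rnorm x <= rnorm (x + of_real s t *: D x).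
Proof.
move=> t0; have [->|x0] := eqVneq x 0; first by rewrite rnorm0 mulr0 rnorm_ge0.
have rx0 := rnorm_gt0 x0.
pose y := of_real s (rnorm x)^-1 *: x.
have y1 : rnorm y = 1.
  by rewrite rnorm_scaler ?invr_ge0 ?rnorm_ge0// mulVf// gt_eqF.
have [f fS] := exists_state y1; have [/= f1 _ fy] := fS.
rewrite mulrC -ler_pdivlMl//.
have -> : (rnorm x)^-1 * rnorm (x + of_real s t *: D x) =
    rnorm (y + of_real s t *: D y).
  rewrite -rnorm_scaler ?invr_ge0 ?rnorm_ge0// scalerDr /y map_opZ; congr (rnorm (_ + _)).
  by rewrite !scalerA mulrC.
have /rnorm_eq1 f1' := f1.
have := real_part_dual_le f (y + of_real s t *: D y); rewrite f1' mul1r.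
apply: le_trans; rewrite map_opD functionalZ real_partD real_part_mulr fy.
rewrite -[X in real_part X + _](of_real1 (s := s)) of_realK lerD2l.
by rewrite -mulrN ler_wpM2l// (D_accretive fS).
Qed.

(** Apply the lower bound at [x - t D x]: the operator [1 - t ^ 2 D ^ 2] has
    no first order term. *)
Lemma accretive_growth (t M : R) (x : X) : 0 <= t <= 1 -> 0 <= d <= 1 / 2 ->
  rnorm D <= M ->
  rnorm (x - of_real s t *: D x) <=
    (1 + M ^+ 2 * t ^+ 2 + d * (2 * (1 + M ^+ 2))) * rnorm x.
Proof.
move=> /andP[t0 t1] /andP[d0 d1] DM.
have M0 : 0 <= M := le_trans (rnorm_ge0 D) DM.
have := accretive_lower_bound (x - of_real s t *: D x) t0.
have -> : x - of_real s t *: D x + of_real s t *: D (x - of_real s t *: D x) =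
    x - of_real s (t ^+ 2) *: D (D x).
  by rewrite map_opB map_opZ scalerBr addrA subrK scalerA -of_realM expr2.
have h : rnorm (x - of_real s (t ^+ 2) *: D (D x)) <= (1 + M ^+ 2 * t ^+ 2) * rnorm x.
  apply: le_trans (ler_rnormB _ _) _; rewrite mulrDl mul1r lerD2l.
  rewrite rnorm_scaler ?sqr_ge0// -mulrA mulrCA ler_wpM2l ?sqr_ge0//.
  apply: le_trans (rnorm_op_ub D _) _; rewrite expr2 -mulrA ler_pM ?rnorm_ge0//.
  by apply: le_trans (rnorm_op_ub D _) _; rewrite ler_wpM2r ?rnorm_ge0.
move=> /le_trans/(_ h); set a := rnorm (x - _); set r := rnorm x => h2.
have r0 : 0 <= r by exact: rnorm_ge0.
have td : t * d <= d by rewrite ler_piMl.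
have td0 : 0 <= t * d by rewrite mulr_ge0.
have t2 : t ^+ 2 <= 1 by rewrite expr_le1.
have t20 : 0 <= t ^+ 2 by rewrite sqr_ge0.
have M20 : 0 <= M ^+ 2 by rewrite sqr_ge0.
have a0 : 0 <= a by exact: rnorm_ge0.
move: h2 td td0 t2 t20 M20; move: (t * d) (t ^+ 2) (M ^+ 2) => u T N h2 ud u0 T1 T0 N0.
have NT : N * T <= N by rewrite ler_piMr.
have NT0 : 0 <= N * T by rewrite mulr_ge0.
have du : 1 <= (1 - u) * (1 + 2 * d) by nra.
apply: (@le_trans _ _ ((1 - u) * (1 + 2 * d) * a)).
  by rewrite ler_peMl.
apply: (@le_trans _ _ ((1 + 2 * d) * ((1 + N * T) * r))).
  by rewrite mulrAC mulrC ler_wpM2l//; lra.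
rewrite mulrA ler_wpM2r//; move: NT NT0; move: (N * T) => P ? ?; nra.
Qed.

End accretive.

Lemma rnorm_le_of_radius (A : operators X) (c : R) : 0 < n ->
  numerical_radius A <= c -> rnorm A <= c / n.
Proof.
by move=> nX vA; rewrite ler_pdivlMr// mulrC (le_trans (numerical_index_le A)).
Qed.

Definition growth_constant : R := (1 + 2 / n) ^+ 2.

(** The operator [1 - c A] is almost accretive, and the one at hand is
    [1 - t (1 - c A)].  That [C] multiplies [t ^ 2] is what makes it possible
    to iterate small steps. *)
Lemma radius_growth (A : operators X) (c : K) (t e : R) : 0 < n ->
  `|c| = 1 -> 0 <= t <= 1 -> 0 <= e <= 1 / 2 ->
  numerical_radius A <= 1 + e ->
  rnorm (of_real s (1 - t) *: op_id X + (of_real s t * c) *: A) <=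
    1 + growth_constant * t ^+ 2 + e * (2 * (1 + growth_constant)).
Proof.
move=> nX c1 t01 e01 vA.
have C0 : 0 <= growth_constant by rewrite sqr_ge0.
pose D := op_id X - c *: A.
have DM : rnorm D <= 1 + 2 / n.
  apply: le_trans (ler_rnormB _ _) _; apply: lerD.
    by apply: rnorm_op_le => // x; rewrite mul1r.
  rewrite rnorm_unimodular//; apply: rnorm_le_of_radius => //.
  by apply: le_trans vA _; lra.
have Dacc p : state_pairs X p -> - e <= real_part (p.1 (D p.2)).
  move=> pS; have [_ _ p1] := pS.
  rewrite /D opB opZ op_idE map_opB functionalZ p1 real_partB.
  rewrite -[X in real_part X - _](of_real1 (s := s)) of_realK.
  have h : real_part (c * p.1 (A p.2)) <= 1 + e.
    apply: le_trans (real_part_le_norm _) _; rewrite normrM c1 mul1r.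
    by apply: le_trans (numerical_radius_ub A pS) _.
  lra.
apply: rnorm_op_le => [|x].
  have t20 := sqr_ge0 t; have := mulr_ge0 C0 t20.
  by have /andP[e0 _] := e01; have := mulr_ge0 e0 C0; lra.
have := accretive_growth Dacc x t01 e01 DM.
rewrite /growth_constant; congr (rnorm _ <= _).
rewrite /D opB opD !opZ !op_idE scalerBr scalerA of_realB of_real1 scalerBl scale1r.
by rewrite opprB addrCA addrC -addrA (addrC (- _)).
Qed.

End NumericalRadius.

(** * Compact operators and their adjoints *)

Section Goldstine.
Context {R : realType} {s : scalars}.
Local Notation K := (scalar_field R s).
Variable X : normedModType K.

Lemma rnorm_row_le m (w : 'rV[K]_m) (c : R) : 0 <= c ->
  (forall i, rnorm (w 0 i : K^o) <= c) -> rnorm w <= c.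
Proof.
move=> c0 wc; have wE : `|w| = mx_norm w by [].
have [w0|/mx_norm_neq0[[i j] wij]] := eqVneq (mx_norm w) 0.
  by rewrite /rnorm wE w0 real_part0.
by rewrite /rnorm wE wij /= (ord1 i); exact: wc.
Qed.

Lemma rnorm_row_ge m (w : 'rV[K]_m) i : rnorm (w 0 i : K^o) <= rnorm w.
Proof.
apply: le_real_part; have -> : `|w| = mx_norm w by [].
by rewrite mx_normE -[leLHS]nngE num_le;
exact: (le_bigmax _ (fun ij => `|w ij.1 ij.2|%:nng) (0, i)).
Qed.

Section coordinates.
Variable l : seq (dual X).
Local Notation m := (size l).

Let coordinates (x : X) : 'rV[K]_m := \row_i (nth 0 l i x : K).

Let coordinates_linear : linear coordinates.
Proof. by move=> a x y; apply/rowP => i; rewrite !mxE map_opD map_opZ. Qed.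

Let coordinates_bound x :
  rnorm (coordinates x) <= (\sum_(i < m) rnorm (nth 0 l i)) * rnorm x.
Proof.
have S0 (P : pred 'I_m) : 0 <= \sum_(i < m | P i) rnorm (nth 0 l i).
  by apply: sumr_ge0 => i _; exact: rnorm_ge0.
apply: rnorm_row_le => [|i]; first by rewrite mulr_ge0 ?rnorm_ge0.
rewrite mxE; apply: le_trans (rnorm_op_ub (nth 0 l i) x) _.
by rewrite ler_wpM2r ?rnorm_ge0// (bigD1 i)//= lerDl.
Qed.

Let Phi := operator_of_bound coordinates_linear coordinates_bound.

Lemma Helly (x2 : dual (dual X)) (e : R) : 0 < e -> exists x : X,
  rnorm x <= rnorm x2 + e /\
  forall f, f \in l -> rnorm (f x - x2 f : K^o) <= e.
Proof.
move=> e0.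
pose w : 'rV[K]_m := \row_i (x2 (nth 0 l i) : K).
have [|f g|f fT|f|g|x [_ xM xw]] := @Helly_selection R s X 'rV[K]_m setT Phi
    x2 0 w (rnorm x2) (rnorm_ge0 x2) _ _ _ _ _ e e0.
- by split=> [|a u v _ _]; rewrite /in_mem /= in_setE.
- exact: map_opD.
- have -> : f = 0 by apply: op_ext => z; rewrite fT.
  exact: map_op0.
- rewrite map_op0 sub0r real_partN -real_partN -map_opN.
  by rewrite -[rnorm f]rnormN real_part_dual_le.
- have gE (v : 'rV[K]_m) : g v = \sum_(i < m) v 0 i * g (delta_mx 0 i).
    rewrite {1}[v]row_sum_delta [LHS]linear_sum; apply: eq_bigr => i _.
    exact: functionalZ.
  have -> : op_comp g Phi = \sum_(i < m) (g (delta_mx 0 i) : K) *: nth 0 l i.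
    apply: op_ext => z; rewrite op_compE gE.
    elim/big_ind2 : _ => [//|? a ? b -> ->//|i _].
    by rewrite mxE opZ mulrC.
  rewrite gE [LHS]linear_sum; apply: eq_bigr => i _.
  by rewrite [LHS]map_opZ mxE mulrC.
exists x; split; first by rewrite -rnormN -sub0r.
move=> f /(nthP 0)[i im <-].
have := rnorm_row_ge (Phi x - w) (Ordinal im); rewrite !mxE /= => /le_trans; exact.
Qed.

End coordinates.

(** Goldstine's theorem: the filter is proper, and bounded points of [X]
    converge along it to [x2] in the weak-star topology. *)
Definition Goldstine_filter (x2 : dual (dual X)) : set_system X :=
  filter_from [set i : seq (dual X) * R | 0 < i.2]
    (fun i => [set x : X | rnorm x <= rnorm x2 + 1 /\
       forall f, f \in i.1 -> rnorm (f x - x2 f : K^o) <= i.2]).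

#[local] Instance Goldstine_filter_proper x2 : ProperFilter (Goldstine_filter x2).
Proof.
apply: filter_from_proper; first apply: filter_from_filter.
- by exists ([::], 1) => /=.
- move=> [l1 e1] [l2 e2] /= e10 e20; exists (l1 ++ l2, Num.min e1 e2) => /=.
    by rewrite lt_min e10.
  move=> x [xM xl]; split; split=> // f fl.
    by apply: le_trans (xl f _) _; rewrite ?mem_cat ?fl// ge_min lexx.
  by apply: le_trans (xl f _) _; rewrite ?mem_cat ?fl ?orbT// ge_min lexx orbT.
move=> [l e] /= e0; have e'0 : 0 < Num.min e 1 by rewrite lt_min e0 ltr01.
have [x [xM xl]] := Helly l x2 e'0; exists x; split.
  by apply: le_trans xM _; rewrite lerD2l ge_min lexx orbT.
by move=> f /xl/le_trans; apply; rewrite ge_min lexx.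
Qed.

End Goldstine.

Section CompactOperators.
Context {R : realType} {s : scalars}.
Local Notation K := (scalar_field R s).
Variable X : normedModType K.

Lemma of_real_lt (a b : R) : (of_real s a < of_real s b) = (a < b).
Proof.
rewrite !lt_neqAle of_real_le; congr (~~ _ && _).
by rewrite (can_eq (of_realK (s := s))).
Qed.

Lemma nbhs_rnorm (V : normedModType K) (c : V) (e : R) : 0 < e ->
  nbhs c [set x | rnorm (x - c) < e].
Proof.
move=> e0; have e0' : 0 < of_real s e by rewrite -(of_real0 (s := s)) of_real_lt.
apply: filterS (nbhsx_ballx c (of_real s e) e0') => x.
by rewrite -ball_normE /= -of_real_rnorm of_real_lt rnorm_distC.
Qed.

Lemma compact_operator_cluster (T : operators X) (G : set_system X) (M : R) :
  0 < M -> compact_operator T -> ProperFilter G -> G [set x | rnorm x <= M] ->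
  exists c : X, forall (A : set X) (e : R), 0 < e -> G A ->
    exists2 x, A x & rnorm (T x - c) < e.
Proof.
move=> M0; rewrite /compact_operator precompactE => Tc GP GM.
pose H : set_system X := fmap (fun x => of_real s M^-1 *: T x) G.
have HP : ProperFilter H by exact: fmap_proper_filter.
have [|c [_ Hc]] := Tc H HP.
  rewrite /H /fmap /=; apply: filterS GM => x /= xM; apply: subset_closure.
  exists (of_real s M^-1 *: x); last by rewrite map_opZ.
  rewrite /= -of_real_rnorm rnorm_scaler ?invr_ge0 ?(ltW M0)// -(of_real1 (s := s)).
  by rewrite of_real_le ler_pdivrMl// mulr1.
exists (of_real s M *: c) => A e e0 GA.
have eM0 : 0 < M^-1 * e by rewrite mulr_gt0 ?invr_gt0.
have [|y [[x Ax <-] /= xc]] := Hc ((fun x => of_real s M^-1 *: T x) @` A) _ _ (nbhs_rnorm c eM0).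
  by rewrite /H /fmap /=; apply: filterS GA => x Ax; exists x.
exists x => //; rewrite -(@ltr_pM2l _ M^-1) ?invr_gt0//.
rewrite -rnorm_scaler ?invr_ge0 ?(ltW M0)// scalerBr scalerA -of_realM mulVf ?gt_eqF//.
by rewrite of_real1 scale1r.
Qed.

(** Since [T] is compact, its second adjoint maps into the canonical image of
    [X], so that only the restriction of [psi] to [X] matters. *)
Lemma compact_second_adjoint (T : operators X)
    (psi : dual (dual (dual X))) (x2 : dual (dual X)) : compact_operator T ->
  psi (op_comp x2 (adjoint _ T)) = x2 (op_comp (op_comp psi (evaluation X)) T).
Proof.
move=> Tc.
have M0 : 0 < rnorm x2 + 1 by rewrite ltr_wpDl ?rnorm_ge0.
have [|c cT] := compact_operator_cluster M0 Tc (Goldstine_filter_proper x2).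
  by exists ([::], 1) => //= x [].
have x2E (f : dual X) : x2 (op_comp f T) = f c.
  apply/eqP; rewrite -subr_eq0; apply/eqP.
  apply: (@rnorm_eq0 R s K^o); apply/le_anti; rewrite rnorm_ge0 andbT.
  apply/ler_addgt0Pl => e e0; rewrite addr0.
  have d0 : 0 < e / (rnorm f + 1) / 2 by rewrite !divr_gt0// ltr_wpDl ?rnorm_ge0.
  have [|x xf xc] := cT [set x | rnorm ((op_comp f T) x - x2 (op_comp f T) : K^o) <= e / 2] _ d0.
    exists ([:: op_comp f T], e / 2) => /=; first by rewrite divr_gt0.
    by move=> x [_ /(_ (op_comp f T))]; rewrite inE eqxx => /(_ isT).
  rewrite rnorm_distC.
  have -> : f c - x2 (op_comp f T) = (op_comp f T x - x2 (op_comp f T)) - f (T x - c).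
    by rewrite map_opB op_compE; ring.
  apply: le_trans (ler_rnormB _ _) _; rewrite [leRHS](splitr e) lerD//.
  apply: le_trans (rnorm_op_ub f _) _.
  apply: (@le_trans _ _ ((rnorm f + 1) * (e / (rnorm f + 1) / 2))).
    by rewrite ler_pM ?rnorm_ge0 ?ltW// ltrDl.
  have f1 : rnorm f + 1 != 0 by rewrite gt_eqF// ltr_wpDl ?rnorm_ge0.
  by rewrite le_eqVlt; apply/orP; left; apply/eqP; field.
have -> : op_comp x2 (adjoint _ T) = evaluation X c.
  by apply: op_ext => f; rewrite op_compE evaluationE -x2E.
by rewrite x2E.
Qed.

(** Weak-star convergence of bounded families is uniform on compact sets;
    otherwise points where [f_ b \o T] is large would cluster at some [c], at
    which [f_ b] does not tend to [0]. *)
Lemma compact_operator_null_net (T : operators X) (D : Type)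
    (F : set_system D) (f_ : D -> dual X) (B : R) :
  compact_operator T -> ProperFilter F -> 0 <= B ->
  (forall b, rnorm (f_ b) <= B) ->
  (forall x (e : R), 0 < e -> F [set b | rnorm (f_ b x : K^o) <= e]) ->
  forall e : R, 0 < e -> F [set b | rnorm (op_comp (f_ b) T) <= e].
Proof.
move=> Tc FP B0 fB f0 e e0; apply: contrapT => nF.
pose bad := [set b | ~ rnorm (op_comp (f_ b) T) <= e].
have FbadP : ProperFilter (within bad F).
  apply: Build_ProperFilter_ex => P FP0; have FP' : F [set b | bad b -> P b] := FP0.
  apply: contrapT => nP; apply: nF; apply: (@filterS _ F _ _ _ _ FP') => b /= bP.
  by apply: contrapT => /bP Pb; apply: nP; exists b.
have /choice[xi xiP] : forall b, exists x : X, bad b ->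
    rnorm x <= 1 /\ e / 2 <= rnorm (f_ b (T x) : K^o).
  move=> b; have [bb|] := pselect (bad b); last by exists 0.
  have e20 : 0 < e / 2 by rewrite divr_gt0.
  have [x [r [x1 xr rb r0]]] := almost_norming (op_comp (f_ b) T) e20.
  exists x => _; split=> //; rewrite op_compE in xr.
  rewrite xr /rnorm norm_of_real of_realK ger0_norm//.
  apply: le_trans rb; rewrite {1}(splitr e) lerBrDl.
  by move: bb; rewrite /bad /= => /negP; rewrite -ltNge -splitr => /ltW; lra.
have [|c cT] := compact_operator_cluster ltr01 Tc (fmap_proper_filter xi FbadP).
  have : F [set b | bad b -> rnorm (xi b) <= 1] by apply: filterE => b /xiP[].
  exact.
have d0 : 0 < e / (8 * (B + 1)) by rewrite divr_gt0// mulr_gt0// ltr_wpDl.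
have e40 : 0 < e / 4 by rewrite divr_gt0.
have := f0 c _ e40 => Fc.
have [|x [b [bb bc xE]] xc] := cT
  [set x | exists b, [/\ bad b, rnorm (f_ b c : K^o) <= e / 4 & x = xi b]] _ d0.
  suff : F [set b | bad b -> exists b', [/\ bad b', rnorm (f_ b' c : K^o) <= e / 4 &
      xi b = xi b']] by exact.
  by apply: filterS Fc => b bc bb; exists b.
have [_ h] := xiP b bb; rewrite -xE in h.
have h1 : rnorm (f_ b (T x) : K^o) <= rnorm (f_ b c : K^o) + rnorm (f_ b (T x - c) : K^o).
  by rewrite map_opB; exact: rnorm_triangle.
have h2 : rnorm (f_ b (T x - c) : K^o) <= (B + 1) * (e / (8 * (B + 1))).
  apply: le_trans (rnorm_op_ub (f_ b) _) _.
  by rewrite ler_pM ?rnorm_ge0 ?ltW//; have := fB b; lra.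
have h3 : (B + 1) * (e / (8 * (B + 1))) = e / 8.
  have B1 : B + 1 != 0 by rewrite gt_eqF// ltr_wpDl.
  by field.
lra.
Qed.

End CompactOperators.

Section RankOneCompact.
Context {R : realType} {s : scalars}.
Local Notation K := (scalar_field R s).
Local Notation I := (@imaginary_unit R s).
Variable X : normedModType K.

Lemma real_part_ge_norm (z : K) : - real_part `|z| <= real_part z.
Proof. by rewrite lerNl -real_partN -normrN real_part_le_norm. Qed.

Lemma norm_imaginary_unit (z : K) : real_part `|I * z| <= real_part `|z|.
Proof.
apply: le_real_part; rewrite normrM ler_piMl// /imaginary_unit; case: s => /=.
  by rewrite normr0.
by rewrite normc_def /= expr0n expr1n add0r sqrtr1.
Qed.

Lemma of_real_scale_continuous (v : X) : continuous (fun a : R => of_real s a *: v).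
Proof.
move=> a; apply/cvgrPdist_le => eps eps0.
have e0 : 0 < real_part eps.
  by rewrite -(@of_real_lt R s) of_real0 real_partK// ltW.
have d0 : 0 < real_part eps / (rnorm v + 1) by rewrite divr_gt0// ltr_wpDl ?rnorm_ge0.
rewrite -(real_partK (ltW eps0)); near=> b.
rewrite -scalerBl -of_realB -of_real_rnorm of_real_le rnormZr.
apply: (@le_trans _ _ (real_part eps / (rnorm v + 1) * (rnorm v + 1))).
  apply: ler_pM; rewrite ?rnorm_ge0 ?lerDl//.
by rewrite divfK// gt_eqF// ltr_wpDl ?rnorm_ge0.
Unshelve. all: by end_near. Qed.

Lemma rank_one_compact (f : dual X) (u : X) : compact_operator (rank_one f u).
Proof.
pose g (p : R * R) : X := of_real s p.1 *: u - of_real s p.2 *: (I *: u).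
have gc : continuous g.
  move=> p; apply: cvgB.
    apply: (@cvg_comp _ _ _ fst (fun a => of_real s a *: u)) (of_real_scale_continuous (v := u) (x := p.1)).
    exact: cvg_fst.
  apply: (@cvg_comp _ _ _ snd (fun a => of_real s a *: _)) (of_real_scale_continuous (x := p.2)).
  exact: cvg_snd.
pose m := rnorm f; pose Q : set R := `[- m, m]%classic.
have Qc : compact (g @` (Q `*` Q)).
  apply: continuous_compact; first exact: continuous_subspaceT.
  by apply: compact_setX; exact: segment_compact.
apply: precompact_subset (compact_precompact (@norm_hausdorff _ X) Qc).
move=> _ [x /= x1 <-].
have fx : real_part `|f x| <= m.
  apply: le_trans (rnorm_op_ub f x) _; rewrite ler_piMr ?rnorm_ge0//.
  by rewrite -(@of_real_le R s) of_real_rnorm of_real1.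
exists (real_part (f x), real_part (I * f x)).
  split; rewrite /Q /= in_itv /=; apply/andP; split.
  - by apply: le_trans (real_part_ge_norm _); rewrite lerN2.
  - by apply: le_trans (real_part_le_norm _) _.
  - apply: le_trans (real_part_ge_norm _); rewrite lerN2.
    by apply: le_trans (norm_imaginary_unit _) _.
  - apply: le_trans (real_part_le_norm _) _.
    by apply: le_trans (norm_imaginary_unit _) _.
by rewrite /g /= scalerA [of_real _ _ * _]mulrC -scalerBl -scalar_reconstruct.
Qed.

End RankOneCompact.

(** * Compact approximation of the identity from the L-projection *)

Section MIdealApproximation.
Context {R : realType} {s : scalars}.
Local Notation K := (scalar_field R s).
Variables (X : normedModType K) (nX : 0 < numerical_index X).
Local Notation n := (numerical_index X).
Local Notation Z := (operators_v nX).
Local Notation J := (compact_operators_v nX).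

Lemma rnorm_operators_v (T : Z) : rnorm T = numerical_radius (T : operators X).
Proof. by rewrite /rnorm of_realK. Qed.

Section post_composition.
Variable g : dual X.

Lemma post_composition_linear : linear (fun T : Z => op_comp g (T : operators X)).
Proof.
by move=> a T U; apply: op_ext => x; rewrite op_compE [LHS]map_opD map_opZ.
Qed.

Lemma post_composition_bound (T : Z) :
  rnorm (op_comp g (T : operators X)) <= rnorm g / n * rnorm T.
Proof.
apply: le_trans (rnorm_op_comp _ _) _; rewrite -mulrA ler_wpM2l ?rnorm_ge0//.
by rewrite mulrC rnorm_operators_v; exact: rnorm_le_of_radius.
Qed.

Definition post_composition : bounded_operator Z (dual X) :=
  operator_of_bound post_composition_linear post_composition_bound.

Lemma rnorm_post_composition : rnorm post_composition <= rnorm g / n.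
Proof.
by apply: rnorm_operator_of_bound; rewrite divr_ge0 ?rnorm_ge0// ltW.
Qed.

End post_composition.

Hypothesis KX : M_ideal J.

Lemma compact_operatorZD (a : K) (S T : operators X) :
  compact_operator S -> compact_operator T -> compact_operator (a *: S + T).
Proof.
move=> Sc Tc; have [[_ JZD] _ _] := KX.
have := JZD a S T; rewrite /in_mem /= !in_setE; exact.
Qed.

Lemma compact_operatorB (S T : operators X) :
  compact_operator S -> compact_operator T -> compact_operator (S - T).
Proof.
by move=> Sc Tc; rewrite addrC -scaleN1r; exact: compact_operatorZD.
Qed.

Lemma compact_operatorZ (a : K) (T : operators X) :
  compact_operator T -> compact_operator (a *: T).
Proof.
move=> Tc; rewrite -[a *: T]addr0; apply: compact_operatorZD => //.
by have [[J0 _] _ _] := KX; move: J0; rewrite /in_mem /= in_setE.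
Qed.

(** [Th f] is the value at the identity of the L-projection of [f]. *)
(** Here [Th f] is [P f] evaluated at the identity.  The last bound is the
    L-decomposition of [f]: as [f] and [P f] agree on the compact [S], the
    difference is [(P f) S + (f - P f) 1]. *)
Lemma M_ideal_functional : exists Th : dual Z -> K,
  [/\ forall a f g, Th (a *: f + g) = a * Th f + Th g,
      forall f, annihilator J f -> Th f = 0,
      forall f, real_part `|Th f| <= rnorm f &
      forall (f : dual Z) (S : operators X), compact_operator S ->
        numerical_radius S <= 1 ->
        real_part (f ((S : operators X) + op_id X) - Th f) <= rnorm f].
Proof.
have [_ _ [P [PP kerP normP]]] := KX.
have nP f : rnorm f = rnorm (P f) + rnorm (f - P f).
  by rewrite -real_partD -normP.
have v1 : rnorm (op_id X : Z) <= 1 by rewrite rnorm_operators_v numerical_radius_id.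
have fP f : annihilator J (f - P f) by rewrite -kerP /= linearB /= PP subrr.
exists (fun f => P f (op_id X)); split.
- by move=> a f g; rewrite linearP.
- by move=> f; rewrite -kerP => /= ->.
- move=> f; apply: le_trans (rnorm_op_ub (P f) (op_id X : Z)) _.
  apply: (@le_trans _ _ (rnorm (P f))); first by rewrite ler_piMr ?rnorm_ge0.
  by rewrite (nP f) lerDl rnorm_ge0.
move=> f S Sc vS.
have -> : f (S + op_id X) - P f (op_id X) = P f S + (f - P f) (op_id X).
  rewrite (map_opD f) opB addrA; congr (_ + _ - _).
  by apply/eqP; rewrite -subr_eq0; apply/eqP; exact: (fP f S Sc).
rewrite real_partD (nP f); apply: lerD.
  apply: le_trans (real_part_dual_le (P f) (S : Z)) _.
  by rewrite ler_piMr ?rnorm_ge0// rnorm_operators_v.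
apply: le_trans (real_part_dual_le (f - P f) (op_id X : Z)) _.
by rewrite ler_piMr ?rnorm_ge0.
Qed.

(** The second property strengthens weak-star to norm convergence, by taking
    the dual of [X] itself as target space in the selection principle; this is
    possible only at those [g] where [E g] is canonical. *)
Lemma M_ideal_approximation :
  exists E : bounded_operator (dual X) (dual (dual (dual X))),
  (forall g (x2 : dual (dual X)) S (e : R), compact_operator S -> numerical_radius S <= 1 -> 0 < e ->
    exists T, [/\ compact_operator T, numerical_radius (S + op_id X - T) <= 1 + e &
      rnorm (x2 (op_comp g T) - E g x2 : K^o) <= e]) /\
  (forall g y S (e : R), E g = evaluation (dual X) y ->
    compact_operator S -> numerical_radius S <= 1 -> 0 < e ->
    exists T, [/\ compact_operator T, numerical_radius (S + op_id X - T) <= 1 + e &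
      rnorm (op_comp g T - y) <= e]).
Proof.
have [Th [ThP Th0 ThM ThS]] := M_ideal_functional.
have ThD f g : Th (f + g) = Th f + Th g.
  by have := ThP 1 f g; rewrite scale1r mul1r.
have ThZ a f : Th (a *: f) = a * Th f.
  by have := ThP a f 0; rewrite addr0 (Th0 0) ?addr0.
pose om g (x2 : dual (dual X)) : dual Z := op_comp x2 (post_composition g).
pose Eg (g : dual X) (x2 : dual (dual X)) : K^o := Th (om g x2).
have Eg_lin g : linear (Eg g).
  by move=> c x2 y2; rewrite /Eg -ThP; congr Th; apply: op_ext.
have Eg_bound g x2 : rnorm (Eg g x2) <= (rnorm g / n) * rnorm x2.
  apply: le_trans (ThM _) _; apply: le_trans (rnorm_op_comp _ _) _.
  by rewrite mulrC ler_wpM2r ?rnorm_ge0// rnorm_post_composition.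
pose E0 (g : dual X) : dual (dual (dual X)) := operator_of_bound (Eg_lin g) (Eg_bound g).
have E0_lin : linear E0.
  move=> a g h; apply: op_ext => x2.
  suff : Th (om (a *: g + h) x2) = a * Th (om g x2) + Th (om h x2) by exact.
  rewrite -ThP; congr Th; apply: op_ext => T.
  have gh : op_comp (a *: g + h) (T : operators X) =
      a *: op_comp g (T : operators X) + op_comp h (T : operators X).
    by apply: op_ext.
  by have := congr1 x2 gh; rewrite map_opD map_opZ.
have E0_bound g : rnorm (E0 g) <= n^-1 * rnorm g.
  rewrite mulrC; apply: rnorm_operator_of_bound.
  by rewrite divr_ge0 ?rnorm_ge0// ltW.
pose E := operator_of_bound E0_lin E0_bound.
have EE g x2 : E g x2 = Th (om g x2) by [].
have [J_submod _ _] := KX.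
have sel (W : normedModType K) (Phi : bounded_operator Z W) (w : W) S (e : R) :
    compact_operator S -> numerical_radius S <= 1 -> 0 < e ->
    (forall l : dual W, Th (op_comp l Phi) = l w) ->
    exists T, [/\ compact_operator T, numerical_radius (S + op_id X - T) <= 1 + e &
      rnorm (Phi T - w) <= e].
  move=> Sc vS e0 lPhi.
  have [f|T [Tc vT wT]] := Helly_selection ler01 J_submod ThD Th0 _ lPhi e0
    (z0 := S + op_id X : Z).
    by rewrite mul1r; exact: ThS.
  exists T; split=> //.
  by rewrite -rnorm_operators_v.
exists E; split=> [g x2 S e Sc vS e0|g y S e Ey Sc vS e0].
  apply: (sel _ (om g x2)) => // l; rewrite EE.
  have -> : op_comp l (om g x2) = (l 1 : K) *: om g x2.
    apply: op_ext => T; rewrite op_compE opZ.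
    transitivity (l ((om g x2 T : K) *: (1 : K^o))).
      by congr (l _); rewrite [RHS]mulr1.
    by rewrite map_opZ; exact: mulrC.
  rewrite ThZ -EE; transitivity (l ((E g x2 : K) *: (1 : K^o))).
    by rewrite map_opZ; exact: mulrC.
  by congr (l _); rewrite [LHS]mulr1.
apply: (sel _ (post_composition g)) => // l.
by rewrite -[LHS]EE Ey.
Qed.

End MIdealApproximation.

(** * The defect of the approximation is skew and canonical *)

Section SmallErrors.
Context {R : realType}.

Lemma le_of_small_errors (a b c : R) : 0 <= c ->
  (forall e : R, 0 < e -> e <= 1 / 2 -> a <= b + c * e) -> a <= b.
Proof.
move=> c0 h; apply/ler_addgt0Pr => d d0.
have c1 : 0 < c + 1 by lra.
pose e := Num.min (1 / 2) (d / (c + 1)).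
have e0 : 0 < e by rewrite /e lt_min; apply/andP; split; [lra|rewrite divr_gt0].
have e1 : e <= 1 / 2 by rewrite /e ge_min lexx.
have ed : (c + 1) * e <= d.
  by rewrite -ler_pdivlMl// mulrC /e ge_min lexx orbT.
have := h e e0 e1; nra.
Qed.

End SmallErrors.

Section RelaxationInequality.
Context {R : realType} {s : scalars}.
Local Notation K := (scalar_field R s).
Variable X : normedModType K.

Lemma rnorm_adjoint_evaluation (psi : dual (dual (dual X))) :
  rnorm (adjoint K^o (evaluation X) psi) <= rnorm psi.
Proof.
apply: le_trans (rnorm_op_comp _ _) _; rewrite ler_piMr ?rnorm_ge0//.
by apply: rnorm_op_le => // x; rewrite mul1r rnorm_evaluation.
Qed.

Lemma adjoint_evaluationK (x : dual X) :
  adjoint K^o (evaluation X) (evaluation (dual X) x) = x.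
Proof. by apply: op_ext. Qed.

Lemma exists_rank_one_moving (g x : dual X) (e : R) : 0 < e -> rnorm x <= rnorm g ->
  exists S : operators X, [/\ compact_operator S, numerical_radius S <= 1 &
    rnorm (op_comp g S - x) <= e].
Proof.
move=> e0 xg; have [g0|g0] := eqVneq g 0.
  have x0 : x = 0.
    by apply: rnorm_eq0; apply/le_anti; rewrite rnorm_ge0 (le_trans xg)// g0 rnorm0.
  exists (rank_one 0 0); split; first exact: rank_one_compact.
    apply: le_trans (numerical_radius_le_norm _) _.
    by apply: le_trans (rnorm_rank_one _ _) _; rewrite !rnorm0 mulr0.
  have -> : op_comp g (rank_one 0 0) - x = 0 by rewrite g0 x0 subr0; apply: op_ext.
  by rewrite rnorm0 ltW.
have gg := rnorm_gt0 g0.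
have [a [r [a1 gar rg r0]]] := almost_norming g e0.
have rg' : r <= rnorm g.
  have := rnorm_op_ub g a; rewrite gar /rnorm norm_of_real of_realK ger0_norm// => /le_trans.
  by apply; rewrite ler_piMr// rnorm_ge0.
pose S := rank_one (of_real s (rnorm g)^-1 *: x) a.
exists S; split; first exact: rank_one_compact.
  apply: le_trans (numerical_radius_le_norm _) _.
  apply: le_trans (rnorm_rank_one _ _) _; rewrite -[leRHS]mulr1 ler_pM ?rnorm_ge0//.
  by rewrite rnorm_scaler ?invr_ge0 ?(ltW gg)// ler_pdivrMl// mulr1.
have -> : op_comp g S - x = of_real s (r / rnorm g - 1) *: x.
  apply: op_ext => z.
  rewrite opB op_compE opZ -[S z]/((of_real s (rnorm g)^-1 * x z) *: a) map_opZ gar.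
  rewrite of_realB of_real1 of_realM.
  transitivity ((of_real s r * of_real s (rnorm g)^-1 - 1) * x z); last by [].
  transitivity ((of_real s (rnorm g)^-1 * x z) * of_real s r - x z); first by [].
  by ring.
rewrite rnormZr ler0_norm ?subr_le0 ?ler_pdivrMr ?mul1r//.
apply: (@le_trans _ _ (- (r / rnorm g - 1) * rnorm g)).
  by rewrite ler_wpM2l// oppr_ge0 subr_le0 ler_pdivrMr// mul1r.
have gg0 : rnorm g != 0 by rewrite gt_eqF.
have -> : - (r / rnorm g - 1) * rnorm g = rnorm g - r by field.
lra.
Qed.

Variable nX : 0 < numerical_index X.
Hypothesis KX : M_ideal (compact_operators_v nX).
Variable E : bounded_operator (dual X) (dual (dual (dual X))).
Hypothesis E_approx : forall g (x2 : dual (dual X)) S (e : R),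
  compact_operator S -> numerical_radius S <= 1 -> 0 < e ->
  exists T, [/\ compact_operator T, numerical_radius (S + op_id X - T) <= 1 + e &
    rnorm (x2 (op_comp g T) - E g x2 : K^o) <= e].
Local Notation C := (growth_constant X).
Local Notation rest := (adjoint K^o (evaluation X)).

Lemma growth_constant_ge0 : 0 <= C.
Proof. exact: sqr_ge0. Qed.

Lemma real_part_scaled_le (r : R) (z : K^o) :
  real_part (of_real s r * z) <= `|r| * rnorm z.
Proof.
rewrite real_part_mulr; apply: le_trans (ler_norm _) _; rewrite normrM ler_wpM2l//.
by rewrite ler_norml real_part_ge_norm real_part_le_norm.
Qed.

(** Test the left hand side against [x2] in the bidual, and choose [S] of rank
    one such that [rest psi \o S] almost has the norm of [rest psi] and almost
    norms [x2]: this produces the term [t * rnorm (rest psi)].  The rest is the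
    value of [psi] at the image of [x2] under the second adjoint of
    [(1 - t) + sg t (S + 1 - T)], whose norm is known. *)
Lemma relaxation_inequality (psi : dual (dual (dual X))) (sg t : R) :
  `|sg| = 1 -> 0 <= t <= 1 ->
  rnorm (of_real s (1 - t) *: psi + of_real s (t * sg) *: (psi - E (rest psi)))
    + t * rnorm (rest psi) <= (1 + C * t ^+ 2) * rnorm psi.
Proof.
move=> sg1 t01; have /andP[t0 t1] := t01.
have C0 := growth_constant_ge0.
set x0 := rest psi; set a := rnorm x0; set N := rnorm psi; set chi := (_ *: psi + _).
have a0 : 0 <= a by exact: rnorm_ge0.
have N0 : 0 <= N by exact: rnorm_ge0.
have aN : a <= N by exact: rnorm_adjoint_evaluation.
have sg2 : sg * sg = 1 by rewrite -[sg * sg]ger0_norm -?expr2 ?sqr_ge0// normrX sg1 expr1n.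
have t20 : 0 <= C * t ^+ 2 by rewrite mulr_ge0 ?sqr_ge0.
rewrite -lerBrDr; apply: rnorm_dual_le => [|x2].
  have ta : t * a <= a by rewrite ler_piMl.
  by have := mulr_ge0 t20 N0; lra.
set b := rnorm x2; have b0 : 0 <= b by exact: rnorm_ge0.
apply: (@le_of_small_errors _ _ _ (2 * (1 + C) * N * b + a + b + 1)).
  by rewrite !addr_ge0// !mulr_ge0// addr_ge0.
move=> e e0 e1.
have [u0 [r [u01 xu rb r0]]] := almost_norming x2 e0.
have [|S [Sc vS Sx]] := @exists_rank_one_moving x0 (of_real s (sg * a) *: u0) e e0.
  by rewrite rnormZr normrM sg1 mul1r (ger0_norm a0) ler_piMr.
have [T [Tc vT Tx]] := E_approx x0 x2 Sc vS e0.
pose B := of_real s (1 - t) *: op_id X + (of_real s t * of_real s sg) *: (S + op_id X - T).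
have BM : rnorm B <= 1 + C * t ^+ 2 + e * (2 * (1 + C)).
  apply: radius_growth => //; last by rewrite ltW.
  by rewrite norm_of_real sg1 of_real1.
pose x3 : dual (dual X) := op_comp x2 (adjoint K^o B).
have x3M : real_part (psi x3) <= N * (b * (1 + C * t ^+ 2 + e * (2 * (1 + C)))).
  apply: le_trans (real_part_dual_le _ _) _; rewrite ler_wpM2l//.
  apply: le_trans (rnorm_op_comp _ _) _; rewrite ler_wpM2l//.
  exact: le_trans (rnorm_adjoint _ _) BM.
(* Isolate the compact part of B, on which [psi] only sees its restriction. *)
have x3E : x3 = of_real s (1 - t + t * sg) *: x2 +
    of_real s (t * sg) *: op_comp x2 (adjoint K^o (S - T)).
  apply: op_ext => f; rewrite opD !opZ !op_compE -!map_opZ -map_opD; congr (x2 _).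
  apply: op_ext => y.
  suff : f (B y) = of_real s (1 - t + t * sg) * f y + of_real s (t * sg) * f ((S - T) y).
    by [].
  rewrite -!functionalZ -map_opD; congr (f _).
  transitivity (of_real s (1 - t) *: y
      + (of_real s t * of_real s sg) *: (S y + y - T y)); first by [].
  rewrite opB (of_realD (1 - t)) !of_realM !scalerDl -[RHS]addrA; congr (_ + _).
  by rewrite -scalerDr addrA [S y + y]addrC.
have psi3 : psi x3 = of_real s (1 - t + t * sg) * psi x2 +
    of_real s (t * sg) * (x2 (op_comp x0 S) - x2 (op_comp x0 T)).
  rewrite x3E map_opD !map_opZ compact_second_adjoint; last exact: compact_operatorB.
  congr (_ + _ * _); rewrite -map_opB; congr (x2 _).
  by apply: op_ext => y; exact: (map_opB x0 (S y) (T y)).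
have xx : x2 (of_real s (sg * a) *: u0) = of_real s (sg * a * r).
  by rewrite functionalZ xu -of_realM.
have chiE : chi x2 = psi x3 - of_real s (t * a * r)
    + of_real s (- (t * sg)) * x2 (op_comp x0 S - of_real s (sg * a) *: u0)
    + of_real s (t * sg) * (x2 (op_comp x0 T) - E x0 x2).
  rewrite map_opB xx psi3 /chi opD !opZ opB.
  have -> : t * a * r = (t * sg) * (sg * a * r).
    by transitivity (t * (sg * sg) * a * r); [rewrite sg2 mulr1|ring].
  transitivity (of_real s (1 - t) * psi x2 + of_real s (t * sg) * (psi x2 - E x0 x2)).
    by [].
  rewrite of_realN (of_realM (t * sg) (sg * a * r)) (of_realD (1 - t)) (of_realM t sg).
  by ring.
have h1 := real_part_scaled_le (- (t * sg)) (x2 (op_comp x0 S - of_real s (sg * a) *: u0)).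
have h2 := real_part_scaled_le (t * sg) (x2 (op_comp x0 T) - E x0 x2).
have h3 := rnorm_op_ub x2 (op_comp x0 S - of_real s (sg * a) *: u0).
rewrite normrN normrM sg1 mulr1 (ger0_norm t0) in h1.
rewrite normrM sg1 mulr1 (ger0_norm t0) in h2.
rewrite chiE !real_partD real_partN of_realK.
have h4 : t * rnorm (x2 (op_comp x0 S - of_real s (sg * a) *: u0) : K^o) <= b * e.
  rewrite -[leRHS]mul1r ler_pM ?rnorm_ge0//; apply: le_trans h3 _.
  by rewrite ler_wpM2l.
have h5 : t * rnorm (x2 (op_comp x0 T) - E x0 x2 : K^o) <= e.
  by rewrite -[leRHS]mul1r ler_pM ?rnorm_ge0.
have h6 : t * a * (b - e) <= t * a * r by rewrite ler_wpM2l// mulr_ge0.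
have h7 : t * a * e <= a * e by rewrite ler_wpM2r ?(ltW e0)// ler_piMl.
rewrite -/b in rb; move: h6; rewrite mulrBr => h6.
move: x3M; set q := real_part (psi x3) => x3M.
have -> : ((1 + C * t ^+ 2) * N - t * a) * b + (2 * (1 + C) * N * b + a + b + 1) * e =
  N * (b * (1 + C * t ^+ 2 + e * (2 * (1 + C)))) - t * a * b + a * e + b * e + e by ring.
lra.
Qed.

Local Notation q x := (x - rest (E x)).

Lemma restricted_growth (x : dual X) (sg t : R) : `|sg| = 1 -> 0 <= t <= 1 ->
  rnorm (of_real s (1 - t) *: x + of_real s (t * sg) *: (q x)) <=
    (1 - t + C * t ^+ 2) * rnorm x.
Proof.
move=> sg1 t01; have := relaxation_inequality (evaluation (dual X) x) sg1 t01.
rewrite adjoint_evaluationK -lerBrDr => h.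
set y := (_ *: x + _).
have -> : y = rest (of_real s (1 - t) *: evaluation (dual X) x +
    of_real s (t * sg) *: (evaluation (dual X) x - E x)).
  by rewrite map_opD !map_opZ map_opB adjoint_evaluationK.
apply: le_trans (rnorm_adjoint_evaluation _) _; apply: le_trans h _.
have C0 := growth_constant_ge0.
apply: (@le_trans _ _ ((1 + C * t ^+ 2) * rnorm x - t * rnorm x)); last by lra.
by rewrite lerB// ler_wpM2l ?rnorm_evaluation// addr_ge0// mulr_ge0 ?sqr_ge0.
Qed.

(** Divide the previous inequality by [t] and let [t] tend to [0]. *)
Lemma rest_E_bounded_below (x : dual X) : rnorm x <= rnorm (rest (E x)).
Proof.
have C0 := growth_constant_ge0.
apply: (@le_of_small_errors _ _ _ (C * rnorm x)); first by rewrite mulr_ge0 ?rnorm_ge0.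
move=> t t0 t1; have t01 : 0 <= t <= 1 by apply/andP; split; lra.
have := restricted_growth x (normr1 R) t01.
have -> : of_real s (1 - t) *: x + of_real s (t * 1) *: (q x) =
    x - of_real s t *: rest (E x).
  by rewrite mulr1 scalerBr of_realB of_real1 scalerBl scale1r addrA subrK.
have := rnorm_triangle x (of_real s t *: rest (E x)).
rewrite (rnorm_scaler _ (ltW t0)) => h1 h2.
rewrite -(ler_pM2l t0); move: h1 h2; nra.
Qed.

End RelaxationInequality.

Lemma relaxation_step (R : realType) (s : scalars)
    (V : lmodType (scalar_field R s)) (t : R) (a b : V) :
  of_real s (1 - t) *: a + of_real s t *: (a - b) = a - of_real s t *: b.
Proof. by rewrite scalerBr of_realB of_real1 scalerBl scale1r addrA subrK. Qed.

Lemma of_real_scale_factor (R : realType) (s : scalars)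
    (V : lmodType (scalar_field R s)) (a b : R) (x y : V) :
  of_real s a *: x + of_real s (a * b) *: y =
  of_real s a *: (x + of_real s b *: y).
Proof. by rewrite scalerDr scalerA -of_realM. Qed.

Lemma relaxation_estimate (R : realType) (a b y k t d C eta V' : R) :
  0 <= C -> 0 <= y -> 0 < k <= 1 -> 0 < t <= 1 ->
  k * (y + 1) <= eta / 4 -> t * (8 * (C + 1) * (y + 1)) <= k * eta ->
  d <= k -> d <= t * k * eta / 4 -> a - (1 - k) * b <= k * y + d ->
  0 <= b -> b <= a ->
  V' <= a - (1 - k) * b + 2 * C * t ^+ 2 * a - t * k * b ->
  a - (1 - k) * b <= V' + d -> a <= eta.
Proof.
move=> C0 y0 /andP[k0 k1] /andP[t0 t1] kB tB dk dt h1 b0 ba h2 h3.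
have tk0 : 0 < t * k by rewrite mulr_gt0.
have tk1 : t * k <= 1 by rewrite mulr_ile1// ltW.
have aB : a <= y + 1.
  rewrite -(ler_pM2l k0).
  have : (1 - k) * b <= (1 - k) * a by rewrite ler_wpM2l// subr_ge0.
  lra.
have h4 : t * k * b <= d + 2 * C * t ^+ 2 * a by lra.
have h5 : 2 * C * t ^+ 2 * a <= t * k * eta / 4.
  have -> : 2 * C * t ^+ 2 * a = t * (2 * C * t * a) by ring.
  have -> : t * k * eta / 4 = t * (k * eta / 4) by ring.
  rewrite ler_pM2l//; apply: (@le_trans _ _ (2 * (C + 1) * t * (y + 1))); last by lra.
  apply: ler_pM => //; [|exact: le_trans ba|].
    by apply: mulr_ge0 (ltW t0); apply: mulr_ge0.
  by rewrite ler_wpM2r ?(ltW t0)//; lra.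
have b_le : b <= eta / 2 by rewrite -(ler_pM2l tk0); lra.
have eta0 : 0 <= eta by have := mulr_ge0 (ltW k0) (addr_ge0 y0 ler01); lra.
have tke : t * k * eta <= eta by rewrite ler_piMl.
have kb0 : 0 <= k * b by rewrite mulr_ge0 ?(ltW k0).
lra.
Qed.

Section Embedding.
Context {R : realType} {s : scalars}.
Local Notation K := (scalar_field R s).
Variable X : normedModType K.
Variable nX : 0 < numerical_index X.
Hypothesis KX : M_ideal (compact_operators_v nX).
Variable E : bounded_operator (dual X) (dual (dual (dual X))).
Hypothesis E_approx : forall g (x2 : dual (dual X)) S (e : R),
  compact_operator S -> numerical_radius S <= 1 -> 0 < e ->
  exists T, [/\ compact_operator T, numerical_radius (S + op_id X - T) <= 1 + e &
    rnorm (x2 (op_comp g T) - E g x2 : K^o) <= e].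
Local Notation C := (growth_constant X).
Local Notation rest := (adjoint K^o (evaluation X)).
Local Notation ev := (evaluation (dual X)).

Section potential.
Variables (y : dual X) (k : R).
Hypothesis k01 : 0 < k <= 1.

Let psi (w : dual X) := ev y - E w.
Let V (w : dual X) : R := rnorm (psi w) - (1 - k) * rnorm (rest (psi w)).

Let V_ge w : k * rnorm (psi w) <= V w.
Proof.
have /andP[k0 k1] := k01; rewrite /V.
have := rnorm_adjoint_evaluation (psi w); nra.
Qed.

(** Along a relaxation step the norm of [psi w] drops by at least [t] times the
    norm of its restriction, and the norm of the restriction by at most as
    much, up to [O(t^2)].  Since [V] counts the latter with the smaller weight
    [1 - k], it decreases. *)
Lemma potential_step (w : dual X) (t : R) : 0 <= t <= 1 ->
  V (w + of_real s t *: rest (psi w)) <=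
    V w + 2 * C * t ^+ 2 * rnorm (psi w) - t * k * rnorm (rest (psi w)).
Proof.
move=> t01; have /andP[k0 k1] := k01; have /andP[t0 t1] := t01.
have C0 := growth_constant_ge0 X.
set x := rest (psi w); set w' := w + _.
(* The step is the relaxation inequality for [sg = 1]. *)
have stepE : psi w' = of_real s (1 - t) *: psi w + of_real s (t * 1) *: (psi w - E x).
  by rewrite mulr1 relaxation_step /psi /w' map_opD map_opZ opprD addrA.
have h1 := relaxation_inequality KX E_approx (psi w) (normr1 R) t01.
have h2 : (1 - t - C * t ^+ 2) * rnorm x <= rnorm (rest (psi w')).
  have := restricted_growth KX E_approx x (normrN1 R) t01.
  have -> : rest (psi w') = of_real s (1 - t) *: x + of_real s t *: (x - rest (E x)).
    by rewrite stepE mulr1 map_opD !map_opZ (map_opB _ (psi w) (E x)).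
  rewrite mulrN1 of_realN scaleNr.
  set u := _ *: x; set v := _ *: (x - _) => h3.
  have u1 : rnorm u = (1 - t) * rnorm x by rewrite rnorm_scaler ?subr_ge0.
  have := ler_rnormD (u - v) (u + v).
  have -> : u - v + (u + v) = of_real s 2 *: u.
    rewrite addrACA addNr addr0 (_ : 2 = 1 + 1 :> R) ?(of_realD 1 1)//.
    by rewrite of_real1 scalerDl scale1r.
  by rewrite rnorm_scaler// u1; lra.
have h3 : rnorm x <= rnorm (psi w) := rnorm_adjoint_evaluation (psi w).
have x0 := rnorm_ge0 x; have p0 := rnorm_ge0 (psi w).
rewrite -/x -stepE in h1; rewrite /V -/x.
move: h1 h2 h3 x0 p0; move: (rnorm (psi w')) (rnorm (rest (psi w'))) => a' b'.
move: (rnorm (psi w)) (rnorm x) => a b h1 h2 h3 b0 a0.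
have Ct0 : 0 <= C * t ^+ 2 by rewrite mulr_ge0 ?sqr_ge0.
have h4 : (1 - k) * ((1 - t - C * t ^+ 2) * b) <= (1 - k) * b'.
  by rewrite ler_wpM2l// subr_ge0.
have h5 : (1 - k) * (C * t ^+ 2 * b) <= C * t ^+ 2 * a.
  apply: (@le_trans _ _ (1 * (C * t ^+ 2 * b))).
    by apply: ler_wpM2r; [exact: mulr_ge0|rewrite lerBlDr lerDl ltW].
  by rewrite mul1r ler_wpM2l.
lra.
Qed.

Lemma almost_minimizer (d : R) : 0 < d ->
  exists w, V w <= k * rnorm y + d /\ forall w', V w <= V w' + d.
Proof.
move=> d0; have /andP[k0 k1] := k01.
have V0 w : 0 <= V w by apply: le_trans (V_ge w); rewrite mulr_ge0 ?rnorm_ge0 ?ltW.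
have inf_V : has_inf [set V w | w in setT].
  by split; [exists (V 0), 0|exists 0 => _ [w _ <-]].
have V_inf w : inf [set V w | w in setT] <= V w.
  by apply: ge_inf; [exact: inf_V.2|exists w].
have [_ [w _ <-] wd] := inf_adherent d0 inf_V.
exists w; split.
  apply: le_trans (ltW wd) _; rewrite lerD2r; apply: le_trans (V_inf 0) _.
  rewrite /V /psi map_op0 subr0 adjoint_evaluationK.
  by have := rnorm_evaluation y; lra.
by move=> w'; apply: le_trans (ltW wd) _; rewrite lerD2r.
Qed.

End potential.

(** At an almost minimizer of [V], a further step cannot gain much, so the
    restriction of [psi w] is small; the excess is at most [V 0 <= k * rnorm y]
    up to an error, hence small as well.  The parameters are chosen in the
    order [k], [t], [d]. *)
Lemma E_dense_range (y : dual X) (eta : R) : 0 < eta ->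
  exists w : dual X, rnorm (ev y - E w) <= eta.
Proof.
move=> eta0; have C0 := growth_constant_ge0 X.
pose B := rnorm y + 1; have y0 := rnorm_ge0 y.
have B0 : 0 < B by rewrite ltr_wpDl.
pose k := Num.min 1 (eta / (4 * B)).
have k0 : 0 < k by rewrite lt_min ltr01 divr_gt0// mulr_gt0.
have k1 : k <= 1 by rewrite ge_min lexx.
have kB : k * B <= eta / 4.
  have : k <= eta / (4 * B) by rewrite ge_min lexx orbT.
  by rewrite ler_pdivlMr ?mulr_gt0//; lra.
pose t := Num.min 1 (k * eta / (8 * (C + 1) * B)).
have CB0 : 0 < 8 * (C + 1) * B by rewrite !mulr_gt0// ltr_wpDl.
have t0 : 0 < t by rewrite lt_min ltr01 divr_gt0// mulr_gt0.
have t1 : t <= 1 by rewrite ge_min lexx.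
have tB : t * (8 * (C + 1) * B) <= k * eta.
  by rewrite -ler_pdivlMr// ge_min lexx orbT.
have tk0 : 0 < t * k by rewrite mulr_gt0.
pose d := Num.min k (t * k * eta / 4).
have d0 : 0 < d by rewrite lt_min k0 divr_gt0// mulr_gt0.
have dk : d <= k by rewrite ge_min lexx.
have dt : d <= t * k * eta / 4 by rewrite ge_min lexx orbT.
have k01 : 0 < k <= 1 by rewrite k0.
have t01' : 0 < t <= 1 by rewrite t0.
have t01 : 0 <= t <= 1 by rewrite ltW.
have [w [w1 w2]] := almost_minimizer y k01 d0.
exists w.
have := w2 (w + of_real s t *: rest (ev y - E w)).
have := potential_step y k01 w t01.
have := rnorm_adjoint_evaluation (ev y - E w).
have := rnorm_ge0 (rest (ev y - E w)).
move: (rnorm (ev y - E w)) (rnorm (rest (ev y - E w))) w1 => a b w1.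
exact: (relaxation_estimate C0 y0 k01 t01' kB tB dk dt w1).
Qed.

(** Approximate [ev (rest (E g))] by some [E w].  After restriction this says
    that [rest (E (g - w))] is small, hence so is [g - w], and [E w] is also
    close to [E g]. *)
Theorem E_canonical (g : dual X) : E g = ev (rest (E g)).
Proof.
apply/eqP; rewrite -subr_eq0; apply/eqP; apply: rnorm_eq0.
apply/le_anti; rewrite rnorm_ge0 andbT.
apply: (@le_of_small_errors _ _ _ (rnorm E + 1)); first by rewrite addr_ge0 ?rnorm_ge0.
move=> e e0 _; rewrite add0r.
have [w we] := E_dense_range (rest (E g)) e0.
have gw : rnorm (g - w) <= e.
  apply: le_trans (rest_E_bounded_below KX E_approx _) _.
  have -> : rest (E (g - w)) = rest (ev (rest (E g)) - E w).
    by rewrite !map_opB adjoint_evaluationK.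
  exact: le_trans (rnorm_adjoint_evaluation _) we.
have -> : E g - ev (rest (E g)) = E (g - w) - (ev (rest (E g)) - E w).
  by rewrite map_opB opprB addrA subrK.
apply: le_trans (ler_rnormB _ _) _; rewrite mulrDl mul1r lerD//.
by apply: le_trans (rnorm_op_ub E _) _; rewrite ler_wpM2l ?rnorm_ge0.
Qed.

End Embedding.

Section SkewDefect.
Context {R : realType} {s : scalars}.
Local Notation K := (scalar_field R s).
Variable X : normedModType K.
Variable nX : 0 < numerical_index X.
Hypothesis KX : M_ideal (compact_operators_v nX).
Local Notation C := (growth_constant X).

(** The operator [q] measures how far the compact operators approximating the
    identity modulo [S] are from converging to it; it is skew, in the sense
    that [1 + t q] is isometric up to second order in [t]. *)
Lemma skew_defect : exists q : bounded_operator (dual X) (dual X),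
  (forall x (sg t : R), `|sg| = 1 -> 0 <= t ->
    rnorm (x + of_real s (t * sg) *: q x) <= (1 + C * t ^+ 2) * rnorm x) /\
  (forall g S (e : R),
    compact_operator S -> numerical_radius S <= 1 -> 0 < e ->
    exists T, [/\ compact_operator T, numerical_radius (S + op_id X - T) <= 1 + e &
      rnorm (op_comp g (op_id X - T) - q g) <= e]).
Proof.
have [E [E1 E2]] := M_ideal_approximation KX.
pose rest := adjoint K^o (evaluation X).
pose q : bounded_operator (dual X) (dual X) := op_id (dual X) - op_comp rest E.
have qE x : q x = x - rest (E x) by [].
exists q; split.
  move=> x sg t sg1 t0; pose u := t / (1 + t).
  have t1 : 0 < 1 + t by lra.
  have t1' : 1 + t != 0 by rewrite gt_eqF.
  have u01 : 0 <= u <= 1 by rewrite divr_ge0 ?(ltW t1)//= ler_pdivrMr//; lra.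
  have := restricted_growth KX E1 x sg1 u01.
  rewrite -qE.
  have -> : 1 - u = (1 + t)^-1 by rewrite /u; field.
  have -> : u * sg = (1 + t)^-1 * (t * sg) by rewrite /u; ring.
  have -> : of_real s (1 + t)^-1 *: x + of_real s ((1 + t)^-1 * (t * sg)) *: q x =
      of_real s (1 + t)^-1 *: (x + of_real s (t * sg) *: q x).
    exact: of_real_scale_factor.
  rewrite rnorm_scaler ?invr_ge0 ?(ltW t1)//.
  rewrite ler_pdivrMl// => /le_trans; apply; rewrite mulrA ler_wpM2r ?rnorm_ge0//.
  have C0 := growth_constant_ge0 X.
  have -> : (1 + t) * ((1 + t)^-1 + C * u ^+ 2) = 1 + C * t ^+ 2 / (1 + t).
    by rewrite /u; field.
  rewrite lerD2l ler_pdivrMr// ler_peMr//; last by rewrite lerDl.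
  by rewrite mulr_ge0 ?sqr_ge0.
move=> g S e Sc vS e0.
have [T [Tc vT gT]] := E2 g _ S e (E_canonical KX E1 g) Sc vS e0.
exists T; split=> //.
have -> : op_comp g (op_id X - T) - q g = - (op_comp g T - rest (E g)).
  rewrite qE; have -> : op_comp g (op_id X - T) = g - op_comp g T.
    by apply: op_ext => x; exact: (map_opB g x (T x)).
  by rewrite !opprB addrC addrA subrK.
by rewrite rnormN.
Qed.

End SkewDefect.

(** * Weak-star null families in the dual *)

Section PowerBounds.
Context {R : realType}.

Lemma one_minus_pow_ge (u : R) m : 0 <= u <= 1 -> 1 - m%:R * u <= (1 - u) ^+ m.
Proof.
move=> /andP[u0 u1]; elim: m => [|m IH]; first by rewrite mul0r subr0 expr0.
rewrite exprS; apply: (@le_trans _ _ ((1 - u) * (1 - m%:R * u))).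
  rewrite -natr1; have : 0 <= m%:R * u * u by rewrite !mulr_ge0.
  by lra.
by rewrite ler_wpM2l// subr_ge0.
Qed.

Lemma one_plus_pow_le (u : R) m : 0 <= u <= 1 -> m%:R * u <= 1 / 2 ->
  (1 + u) ^+ m <= 1 + 2 * (m%:R * u).
Proof.
move=> u01 mu; have /andP[u0 u1] := u01.
have h1 : (1 + u) ^+ m * (1 - u) ^+ m <= 1.
  rewrite -exprMn exprn_ile1//.
    by rewrite mulr_ge0 ?subr_ge0// addr_ge0.
  by have := mulr_ge0 u0 u0; lra.
have h2 := one_minus_pow_ge m u01.
have h3 : 0 <= (1 + u) ^+ m by rewrite exprn_ge0// addr_ge0.
have h4 : (1 + u) ^+ m * (1 - m%:R * u) <= 1.
  by apply: le_trans h1; rewrite ler_wpM2l.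
have mu0 : 0 <= m%:R * u by rewrite mulr_ge0.
move: h3 h4 mu mu0; move: ((1 + u) ^+ m) (m%:R * u) => b v; nra.
Qed.

End PowerBounds.

Section WeakStarNullFamilies.
Context {R : realType} {s : scalars}.
Local Notation K := (scalar_field R s).
Variable X : normedModType K.
Variable nX : 0 < numerical_index X.
Hypothesis KX : M_ideal (compact_operators_v nX).
Local Notation n := (numerical_index X).
Local Notation C := (growth_constant X).
Variables (D : Type) (F : set_system D) (f_ : D -> dual X) (B : R).
Hypothesis FP : ProperFilter F.
Hypothesis B0 : 0 <= B.
Hypothesis f_bounded : forall b, rnorm (f_ b) <= B.
Hypothesis f_null : forall x (e : R), 0 < e -> F [set b | rnorm (f_ b x : K^o) <= e].

Definition limsup_le (V : normedModType K) (v_ : D -> V) (v : V) (c : R) : Prop :=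
  forall e : R, 0 < e -> F [set b | rnorm (v + v_ b) <= c + e].

Lemma limsup_le_of_small (V : normedModType K) (v_ : D -> V) (v : V) (c M : R) : 0 <= M ->
  (forall e : R, 0 < e -> e <= 1 / 2 -> F [set b | rnorm (v + v_ b) <= c + M * e]) ->
  limsup_le v_ v c.
Proof.
move=> M0 h e e0; have M1 : 0 < M + 1 by lra.
pose d := Num.min (1 / 2) (e / (M + 1)).
have d0 : 0 < d by rewrite /d lt_min; apply/andP; split; [lra|rewrite divr_gt0].
have d1 : d <= 1 / 2 by rewrite /d ge_min lexx.
have de : (M + 1) * d <= e by rewrite -ler_pdivlMl// mulrC /d ge_min lexx orbT.
apply: filterS (h d d0 d1) => b /= /le_trans; apply; rewrite lerD2l; nra.
Qed.

Lemma limsup_le_compact_perturbation (L : operators X) (g : dual X) (c : R) :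
  compact_operator L -> limsup_le f_ g c -> forall e : R, 0 < e ->
  F [set b | rnorm (op_comp g (op_id X + L) + f_ b) <=
       rnorm (op_id X + L) * (c + e) + e].
Proof.
move=> Lc gc e e0.
have := compact_operator_null_net Lc FP B0 f_bounded f_null e0.
apply: filterS2 (gc e e0) => b /= gb fb.
have -> : op_comp g (op_id X + L) + f_ b =
    op_comp (g + f_ b) (op_id X + L) - op_comp (f_ b) L.
  apply: op_ext => x.
  transitivity (g (x + L x) + f_ b x); first by [].
  transitivity (g (x + L x) + f_ b (x + L x) - f_ b (L x)); last by [].
  by rewrite (map_opD (f_ b)); ring.
apply: le_trans (ler_rnormB _ _) _; rewrite lerD//.
apply: le_trans (rnorm_op_comp _ _) _.
by rewrite mulrC ler_wpM2l ?rnorm_ge0.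
Qed.

Variable q : bounded_operator (dual X) (dual X).
Hypothesis q_skew : forall x (sg t : R), `|sg| = 1 -> 0 <= t ->
  rnorm (x + of_real s (t * sg) *: q x) <= (1 + C * t ^+ 2) * rnorm x.
Hypothesis q_approx : forall g S (e : R),
  compact_operator S -> numerical_radius S <= 1 -> 0 < e ->
  exists T, [/\ compact_operator T, numerical_radius (S + op_id X - T) <= 1 + e &
    rnorm (op_comp g (op_id X - T) - q g) <= e].

Lemma exists_compact_perturbation (g x : dual X) (e : R) :
  0 < e -> rnorm x <= rnorm g ->
  exists L : operators X, [/\ compact_operator L,
    numerical_radius (op_id X + L) <= 1 + e &
    rnorm (op_comp g L - (x + q g - g)) <= 2 * e].
Proof.
move=> e0 xg; have [S [Sc vS Sx]] := exists_rank_one_moving e0 xg.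
have [T [Tc vT Tx]] := q_approx g Sc vS e0.
exists (S - T); split.
- exact: (compact_operatorB KX).
- by rewrite addrCA addrA.
have -> : op_comp g (S - T) - (x + q g - g) =
    (op_comp g S - x) + (op_comp g (op_id X - T) - q g).
  apply: op_ext => z.
  transitivity (g (S z - T z) - (x z + q g z - g z)); first by [].
  transitivity (g (S z) - x z + (g (z - T z) - q g z)); last by [].
  by rewrite !map_opB; ring.
by apply: le_trans (ler_rnormD _ _) _; lra.
Qed.

(** Use the compact perturbation [1 + t L] of the identity, where [S], and so
    the transpose of [L], is chosen to fix [g] up to the defect [q]. *)
Lemma limsup_le_skew_step (g : dual X) (c t : R) : 0 <= c -> 0 <= t <= 1 ->
  limsup_le f_ g c ->
  limsup_le f_ (g + of_real s t *: q g) ((1 + C * t ^+ 2) * c).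
Proof.
move=> c0 t01 gc; have C0 := growth_constant_ge0 X.
have /andP[t0 t1] := t01.
apply: (@limsup_le_of_small _ _ _ _ ((1 + C) + 2 * (1 + C) * (c + 1) + 3)).
  by rewrite !addr_ge0// !mulr_ge0// addr_ge0.
move=> e e0 e1.
have [L [Lc vL Lg]] := exists_compact_perturbation e0 (lexx (rnorm g)).
have tLc : compact_operator (of_real s t *: L) by exact: (compact_operatorZ KX).
have := limsup_le_compact_perturbation tLc gc e0; apply: filterS => b /= h.
have tLM : rnorm (op_id X + of_real s t *: L) <= 1 + C * t ^+ 2 + e * (2 * (1 + C)).
  have -> : op_id X + of_real s t *: L =
      of_real s (1 - t) *: op_id X + (of_real s t * 1) *: (op_id X + L).
    by rewrite mulr1 scalerDr addrA -scalerDl -of_realD subrK of_real1 scale1r.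
  by apply: radius_growth => //; [rewrite normr1|rewrite ltW].
have -> : g + of_real s t *: q g + f_ b =
    op_comp g (op_id X + of_real s t *: L) + f_ b
    - of_real s t *: (op_comp g L - (g + q g - g)).
  apply: op_ext => z.
  transitivity (g z + of_real s t * q g z + f_ b z); first by [].
  transitivity (g (z + of_real s t *: L z) + f_ b z
    - of_real s t * (g (L z) - (g z + q g z - g z))); last by [].
  by rewrite map_opD functionalZ; ring.
apply: le_trans (ler_rnormB _ _) _; rewrite (rnorm_scaler _ t0).
have t20 : 0 <= t ^+ 2 by exact: sqr_ge0.
have t21 : C * t ^+ 2 <= C by rewrite ler_piMr// expr_le1.
have h2 : t * rnorm (op_comp g L - (g + q g - g)) <= 2 * e.
  by rewrite -[leRHS]mul1r ler_pM ?rnorm_ge0.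
have h3 : rnorm (op_id X + of_real s t *: L) * (c + e) <=
    (1 + C * t ^+ 2 + e * (2 * (1 + C))) * (c + e).
  by rewrite ler_wpM2r// addr_ge0// ltW.
apply: (@le_trans _ _ ((1 + C * t ^+ 2 + e * (2 * (1 + C))) * (c + e) + e + 2 * e)).
  by lra.
have h4 : C * t ^+ 2 * e <= C * e by rewrite ler_wpM2r// ltW.
have h5 : e * (2 * (1 + C)) * (c + e) <= e * (2 * (1 + C)) * (c + 1).
  by rewrite ler_wpM2l ?mulr_ge0 ?addr_ge0 ?(ltW e0)//; lra.
lra.
Qed.

(** A single full step, with norm at most [(1 + e) / n], moves [g] to any [x]
    of smaller norm, up to the defect [q g]. *)
Lemma limsup_le_jump (g x : dual X) (c : R) : 0 <= c -> rnorm x <= rnorm g ->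
  limsup_le f_ g c -> limsup_le f_ (x + q g) (c / n).
Proof.
move=> c0 xg gc.
have in0 : 0 <= n^-1 by rewrite invr_ge0 ltW.
apply: (@limsup_le_of_small _ _ _ _ ((c + 2) / n + 3)).
  by rewrite addr_ge0// mulr_ge0// addr_ge0.
move=> e e0 e1.
have [L [Lc vL Lg]] := exists_compact_perturbation e0 xg.
have := limsup_le_compact_perturbation Lc gc e0; apply: filterS => b /= h.
have LM : rnorm (op_id X + L) <= (1 + e) / n by exact: rnorm_le_of_radius.
have -> : x + q g + f_ b =
    op_comp g (op_id X + L) + f_ b - (op_comp g L - (x + q g - g)).
  apply: op_ext => z.
  transitivity (x z + q g z + f_ b z); first by [].
  transitivity (g (z + L z) + f_ b z
    - (g (L z) - (x z + q g z - g z))); last by [].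
  by rewrite map_opD; ring.
apply: le_trans (ler_rnormB _ _) _.
have h3 : rnorm (op_id X + L) * (c + e) <= (1 + e) / n * (c + e).
  by rewrite ler_wpM2r// addr_ge0// ltW.
have h4 : (1 + e) / n * (c + e) <= c / n + (c + 2) / n * e.
  have -> : (1 + e) / n * (c + e) = ((1 + e) * (c + e)) * n^-1 by ring.
  have -> : c / n + (c + 2) / n * e = (c + (c + 2) * e) * n^-1 by ring.
  have ee : e * e <= e by rewrite ler_piMl ?(ltW e0)//; lra.
  by rewrite ler_wpM2r//; lra.
lra.
Qed.

Section iteration.
Variables (g : dual X) (c t : R).
Hypothesis c0 : 0 <= c.
Hypothesis t01 : 0 <= t <= 1.
Hypothesis Ct1 : C * t ^+ 2 <= 1.
Hypothesis gc : limsup_le f_ g c.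

Let u := C * t ^+ 2.
Let y k := iter k (fun y : dual X => y + of_real s t *: q y) g.

Let u0 : 0 <= u.
Proof. by rewrite mulr_ge0 ?sqr_ge0 ?growth_constant_ge0. Qed.

Let t0 : 0 <= t. Proof. by case/andP: t01. Qed.

Lemma limsup_le_iterate k : limsup_le f_ (y k) ((1 + u) ^+ k * c).
Proof.
elim: k => [|k IH]; first by rewrite expr0 mul1r.
rewrite exprS -mulrA; apply: limsup_le_skew_step => //.
by rewrite mulr_ge0// exprn_ge0// addr_ge0.
Qed.

Lemma rnorm_iterate_le k : rnorm (y k) <= (1 + u) ^+ k * rnorm g.
Proof.
elim: k => [|k IH]; first by rewrite expr0 mul1r.
rewrite exprS -mulrA; have := q_skew (y k) (normr1 R) t0; rewrite mulr1 => /le_trans.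
by apply; rewrite ler_wpM2l// addr_ge0.
Qed.

(** By convexity, since [1 - t q] does not expand much either. *)
Lemma rnorm_iterate_ge k : (1 - u) ^+ k * rnorm g <= rnorm (y k).
Proof.
elim: k => [|k IH]; first by rewrite expr0 mul1r.
rewrite exprS -mulrA; apply: (@le_trans _ _ ((1 - u) * rnorm (y k))).
  by rewrite ler_wpM2l// subr_ge0.
have := q_skew (y k) (normrN1 R) t0; rewrite mulrN1 of_realN scaleNr.
set v := _ *: q _ => h1; have := ler_rnormD (y k - v) (y k + v).
rewrite addrACA addNr addr0.
have -> : y k + y k = of_real s 2 *: y k.
  by rewrite (_ : 2 = 1 + 1 :> R) ?(of_realD 1 1)// of_real1 scalerDl scale1r.
rewrite rnorm_scaler// -[y k.+1]/(y k + v) => h2.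
have h1' : rnorm (y k - v) <= (1 + u) * rnorm (y k) := h1.
lra.
Qed.

Lemma sum_q_iterate m : of_real s t *: \sum_(k < m) q (y k) = y m - g.
Proof.
elim: m => [|m IH]; first by rewrite big_ord0 scaler0 subrr.
by rewrite big_ord_recr/= scalerDr IH addrAC.
Qed.

(** The factor [(1 - u) ^+ m] keeps the target below the norm of every iterate,
    so that the jump is allowed from each of them. *)
Lemma limsup_le_average (f : dual X) (m : nat) (e : R) : rnorm f <= rnorm g -> 0 < e ->
  F [set b | rnorm (\sum_(k < m) (of_real s ((1 - u) ^+ m) *: f + q (y k) + f_ b)) <=
    m%:R * ((1 + u) ^+ m * c / n + e)].
Proof.
move=> fg e0.
have u1 : 0 <= 1 - u by rewrite subr_ge0.
suff H j : (j <= m)%N ->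
    F [set b | rnorm (\sum_(k < j) (of_real s ((1 - u) ^+ m) *: f + q (y k) + f_ b)) <=
    j%:R * ((1 + u) ^+ m * c / n + e)] by exact: H.
elim: j => [_|j IH jm].
  by apply: filterE => b /=; rewrite big_ord0 rnorm0 mul0r.
have a_ge : rnorm (of_real s ((1 - u) ^+ m) *: f) <= rnorm (y j).
  rewrite rnorm_scaler ?exprn_ge0//; apply: le_trans (rnorm_iterate_ge j).
  rewrite ler_pM ?exprn_ge0 ?rnorm_ge0//.
  by apply: ler_wiXn2l (ltnW jm) => //; rewrite gerBl.
have c'0 : 0 <= (1 + u) ^+ j * c by rewrite mulr_ge0// exprn_ge0// addr_ge0.
have := limsup_le_jump c'0 a_ge (limsup_le_iterate j) e0.
apply: filterS2 (IH (ltnW jm)) => b /= h1 h2.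
rewrite big_ord_recr/=; apply: le_trans (ler_rnormD _ _) _.
rewrite -natr1 mulrDl mul1r lerD//; apply: le_trans h2 _.
rewrite lerD2r ler_wpM2r ?invr_ge0 ?(ltW nX)// ler_wpM2r//.
by apply: ler_weXn2l (ltnW jm); rewrite lerDl.
Qed.

Lemma limsup_le_after_average (f : dual X) (m : nat) (e : R) :
  rnorm f <= rnorm g -> 0 < e -> 0 < t -> (0 < m)%N ->
  F [set b | rnorm (f + f_ b) <= (1 - (1 - u) ^+ m) * rnorm f
      + (1 + u) ^+ m * c / n + e + ((1 + u) ^+ m + 1) * rnorm g / (t * m%:R)].
Proof.
move=> fg e0 tgt0 m0; apply: filterS (limsup_le_average m fg e0) => b /=.
have mR : 0 < m%:R :> R by rewrite ltr0n.
set a := (1 - u) ^+ m; set a' := (1 + u) ^+ m.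
have a1 : a <= 1 by rewrite exprn_ile1 ?subr_ge0// gerBl.
have sumE : \sum_(k < m) (of_real s a *: f + q (y k) + f_ b) =
    of_real s m%:R *: ((f + f_ b) - of_real s (1 - a) *: f)
    + of_real s t^-1 *: (y m - g).
  rewrite -sum_q_iterate scalerA -of_realM mulVf ?gt_eqF// of_real1 scale1r.
  have -> : f + f_ b - of_real s (1 - a) *: f = of_real s a *: f + f_ b.
    by rewrite of_realB of_real1 scalerBl scale1r opprB addrAC [f + (_ - _)]addrC subrK.
  elim: (m) => [|j IH]; first by rewrite !big_ord0 of_real0 scale0r addr0.
  rewrite !big_ord_recr/= IH -natr1 of_realD of_real1 scalerDl scale1r.
  by rewrite [_ + q _ + f_ b]addrAC addrACA.
rewrite sumE => h.
set w := f + f_ b - _ in h.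
have h1 : m%:R * rnorm w <= m%:R * (a' * c / n + e) + t^-1 * ((a' + 1) * rnorm g).
  rewrite -(rnorm_scaler _ (ltW mR)).
  apply: le_trans (rnorm_triangle _ (of_real s m%:R *: w + of_real s t^-1 *: (y m - g))) _.
  apply: lerD h _; rewrite opprD addrA subrr add0r rnormN rnorm_scaler ?invr_ge0//.
  rewrite ler_wpM2l ?invr_ge0//; apply: le_trans (ler_rnormB _ _) _.
  by rewrite mulrDl mul1r lerD2r rnorm_iterate_le.
have h2 : rnorm w <= a' * c / n + e + (a' + 1) * rnorm g / (t * m%:R).
  rewrite -(ler_pM2l mR); apply: le_trans h1 _; rewrite [leRHS]mulrDr lerD2l.
  rewrite le_eqVlt; apply/orP; left; apply/eqP.
  have m1 : m%:R != 0 :> R by rewrite gt_eqF.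
  have t1 : t != 0 by rewrite gt_eqF.
  by field; rewrite ?m1 ?t1.
have h3 : rnorm (f + f_ b) <= (1 - a) * rnorm f + rnorm w.
  have -> : f + f_ b = of_real s (1 - a) *: f + w by rewrite [RHS]addrC /w subrK.
  by apply: le_trans (ler_rnormD _ _) _; rewrite rnorm_scaler ?subr_ge0.
by apply: le_trans h3 _; lra.
Qed.

End iteration.

(** The averaged bound is off by terms of order [m t ^ 2] and [(t m)^-1]; with
    [t = j ^- 2] and [m = j ^ 3] both are of order [j^-1]. *)
Theorem weak_star_null_limsup_le (f g : dual X) (c : R) : 0 <= c ->
  rnorm f <= rnorm g -> limsup_le f_ g c -> limsup_le f_ f (c / n).
Proof.
move=> c0 fg gc e e0; have C0 := growth_constant_ge0 X.
have cn0 : 0 <= c / n by rewrite divr_ge0// ltW.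
have f0 := rnorm_ge0 f; have g0 := rnorm_ge0 g.
pose M := C * rnorm f + 2 * C * (c / n) + 3 * rnorm g.
have M0 : 0 <= M by have := mulr_ge0 C0 f0; have := mulr_ge0 C0 cn0; rewrite /M; lra.
pose z := 1 + 2 * C + 2 * M / e.
have Me0 : 0 <= 2 * M / e by rewrite !mulr_ge0 ?invr_ge0// ltW.
have z0 : 0 <= z by rewrite /z; lra.
pose j := Num.bound z.
have jz : z < j%:R by apply: archi_boundP.
have j1 : 1 <= j%:R :> R by move: jz; rewrite /z; lra.
have jC : 2 * C <= j%:R by move: jz; rewrite /z; lra.
have jM : 2 * M / e <= j%:R by move: jz; rewrite /z; lra.
have j0 : 0 < j%:R :> R by lra.
have jn0 : j%:R != 0 :> R by rewrite gt_eqF.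
pose i : R := j%:R^-1.
have i0 : 0 < i by rewrite invr_gt0.
have i1 : i <= 1 by rewrite invf_le1.
have iC : C * i <= 1 / 2 by rewrite ler_pdivrMr//; lra.
have iM : M * i <= e / 2.
  rewrite ler_pdivrMr//; move: jM; rewrite ler_pdivrMr//; lra.
have i2 : i ^+ 2 <= 1 by rewrite expr_le1// ltW.
have i20 : 0 < i ^+ 2 by rewrite exprn_gt0.
have i4 : (i ^+ 2) ^+ 2 <= 1 by rewrite expr_le1// ltW.
have t01 : 0 <= i ^+ 2 <= 1 by rewrite (ltW i20).
have i42 : (i ^+ 2) ^+ 2 <= i.
  rewrite -exprM exprS ler_piMr ?(ltW i0)// expr_le1 ?(ltW i0)//.
have Ct : C * (i ^+ 2) ^+ 2 <= 1.
  apply: (@le_trans _ _ (C * i)); first by rewrite ler_wpM2l.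
  lra.
have Ct0 : 0 <= C * (i ^+ 2) ^+ 2 by rewrite mulr_ge0 ?sqr_ge0.
have m0 : (0 < j ^ 3)%N by rewrite expn_gt0 -(ltr0n R) j0.
have e20 : 0 < e / 2 by rewrite divr_gt0.
have mu : (j ^ 3)%:R * (C * (i ^+ 2) ^+ 2) = C * i.
  by rewrite natrX /i; field.
have tm : i ^+ 2 * (j ^ 3)%:R = j%:R by rewrite natrX /i; field.
have := limsup_le_after_average c0 t01 Ct gc fg e20 i20 m0.
apply: filterS => b /= h; apply: le_trans h _.
have u01 : 0 <= C * (i ^+ 2) ^+ 2 <= 1 by rewrite Ct0.
have := one_minus_pow_ge (j ^ 3) u01; have := one_plus_pow_le (m := j ^ 3) u01.
rewrite mu tm => /(_ iC).
move: ((1 + _) ^+ _) ((1 - _) ^+ _) => a' a h1 h2.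
have k1 : (1 - a) * rnorm f <= C * i * rnorm f by rewrite ler_wpM2r//; lra.
have k2 : a' * c / n <= (1 + 2 * (C * i)) * (c / n) by rewrite -mulrA ler_wpM2r.
have k3 : (a' + 1) * rnorm g / j%:R <= 3 * rnorm g * i.
  by rewrite ler_wpM2r ?(ltW i0)// ler_wpM2r//; lra.
move: iM; rewrite /M; lra.
Qed.

End WeakStarNullFamilies.

(** * Weakly null families by duality *)

Section WeakStarLimit.
Context {R : realType} {s : scalars}.
Local Notation K := (scalar_field R s).
Local Notation I := (@imaginary_unit R s).
Variable X : normedModType K.
Variables (D : Type) (U : set_system D).
Hypothesis UU : UltraFilter U.

Lemma ultra_real_limit (r : D -> R) (M : R) : (forall b, `|r b| <= M) ->
  exists l : R, forall e : R, 0 < e -> U [set b | `|r b - l| <= e].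
Proof.
move=> rM; have UP : ProperFilter U by exact: (@ultra_proper _ _ UU).
have := segment_compact (a := - M) (b := M).
move=> /(_ (fmap r U) (fmap_proper_filter r UP)) [|l [_ Hl]].
  rewrite /fmap /=; apply: filterE => b /=; rewrite in_itv /=.
  by rewrite -ler_norml.
exists l => e e0; have [//|nU] := in_ultra_setVsetC [set b | `|r b - l| <= e] UU.
have [|z [[b /= bn <-] lz]] := Hl (r @` ~` [set b | `|r b - l| <= e]) _ _ (nbhsx_ballx (l : R^o) e e0).
  by rewrite /fmap /=; apply: filterS nU => b nb; exists b.
move: lz; rewrite -ball_normE /= distrC => /ltW lz.
by exfalso; exact: bn.
Qed.

(** The Banach-Alaoglu theorem, for families indexed along an ultrafilter. *)
Lemma ultra_functional_limit (u : D -> dual X) : (forall b, rnorm (u b) <= 1) ->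
  exists l : dual X, rnorm l <= 1 /\
    forall x (e : R), 0 < e -> U [set b | rnorm (u b x - l x : K^o) <= e].
Proof.
move=> u1; have UP : ProperFilter U by exact: (@ultra_proper _ _ UU).
have /choice[l lP] : forall x : X, exists r : R, forall e : R, 0 < e ->
    U [set b | `|real_part (u b x) - r| <= e].
  move=> x; apply: (@ultra_real_limit _ (rnorm x)) => b.
  have ux : rnorm (u b x : K^o) <= rnorm x.
    by apply: le_trans (rnorm_op_ub (u b) x) _; rewrite ler_piMl ?rnorm_ge0.
  rewrite ler_norml; apply/andP; split.
    by apply: le_trans (real_part_ge_norm _); rewrite lerN2.
  by apply: le_trans (real_part_le_norm _) _.
have small (a : R) : (forall e : R, 0 < e -> `|a| <= 3 * e) -> a = 0.
  move=> h; apply/eqP; rewrite -normr_le0; apply/ler_addgt0Pl => e e0; rewrite addr0.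
  by apply: le_trans (h (e / 3) _) _; [rewrite divr_gt0|rewrite mulrC divfK].
have lD x y : l (x + y) = l x + l y.
  apply/eqP; rewrite -subr_eq0; apply/eqP; apply: small => e e0.
  have [b [[/= h1 h2] h3]] := filter_ex (filterI (filterI (lP x e e0) (lP y e e0)) (lP (x + y) e e0)).
  move: h1 h2 h3; rewrite map_opD real_partD !ler_norml.
  move=> /andP[? ?] /andP[? ?] /andP[? ?]; apply/andP; split; lra.
have lZ r x : l (of_real s r *: x) = r * l x.
  apply/eqP; rewrite -subr_eq0; apply/eqP; apply: small => e e0.
  have d0 : 0 < e / (`|r| + 1) by rewrite divr_gt0// ltr_wpDl.
  have [b [/= h1 h2]] := filter_ex (filterI (lP x _ d0) (lP (of_real s r *: x) e e0)).
  rewrite functionalZ real_part_mulr in h2.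
  have -> : l (of_real s r *: x) - r * l x = r * (real_part (u b x) - l x)
      - (r * real_part (u b x) - l (of_real s r *: x)) by ring.
  apply: le_trans (ler_normB _ _) _; rewrite normrM.
  have : `|r| * `|real_part (u b x) - l x| <= (`|r| + 1) * (e / (`|r| + 1)).
    by apply: ler_pM => //; rewrite lerDl.
  by rewrite [(_ + 1) * _]mulrC divfK ?gt_eqF ?ltr_wpDl//; lra.
have lM x : l x <= 1 * rnorm x.
  apply/ler_addgt0Pr => e e0; have [b /= h] := filter_ex (lP x e e0).
  have := real_part_dual_le (u b) x.
  have : rnorm (u b) * rnorm x <= 1 * rnorm x by rewrite ler_wpM2r ?rnorm_ge0.
  by move: h; rewrite ler_norml => /andP[? ?]; lra.
have [f fl f1] := complexify ler01 lD lZ lM.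
exists f; split=> // x e e0.
have e20 : 0 < e / 2 by rewrite divr_gt0.
apply: filterS2 (lP x _ e20) (lP (I *: x) _ e20) => b /= h1 h2.
have -> : u b x - f x = (u b - f) x by [].
rewrite (scalar_reconstruct ((u b - f) x)) -functionalZ !opB !real_partB !fl.
apply: le_trans (ler_rnormB _ _) _; rewrite (splitr e); apply: lerD.
  by rewrite /rnorm norm_of_real of_realK.
apply: le_trans (norm_imaginary_unit _) _.
by rewrite norm_of_real of_realK.
Qed.

End WeakStarLimit.

Section WeaklyNullFamilies.
Context {R : realType} {s : scalars}.
Local Notation K := (scalar_field R s).
Variable X : normedModType K.
Variable nX : 0 < numerical_index X.
Hypothesis KX : M_ideal (compact_operators_v nX).
Local Notation n := (numerical_index X).
Variables (D : Type) (F : set_system D) (x_ : D -> X).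
Hypothesis FP : ProperFilter F.
Hypothesis x_null : forall (f : dual X) (e : R), 0 < e ->
  F [set b | rnorm (f (x_ b) : K^o) <= e].

(** Otherwise choose an ultrafilter along which the bound on [x + x_ b] fails,
    let [u b] norm [x + x_ b], let [l] be the weak-star limit of [u] and put
    [f_ b = u b - l].  If [v] has norm at most [rnorm l] and norms [y] in the
    sense that [v y = rnorm l * rnorm y], the result on the dual bounds
    [v + f_ b] by [n^-1], and [rnorm (x + x_ b) = u b (x + x_ b)] is at most
    [(v + f_ b) (y + x_ b)] up to null terms, as [f_ b (x_ b)] occurs in
    both. *)
Theorem weakly_null_limsup_le (x y : X) (c : R) : 0 <= c ->
  rnorm x <= rnorm y -> limsup_le F x_ y c -> limsup_le F x_ x (c / n).
Proof.
move=> c0 xy yc e e0; apply: contrapT => nF.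
pose bad := [set b | ~ rnorm (x + x_ b) <= c / n + e].
have FbadP : ProperFilter (within bad F).
  apply: Build_ProperFilter_ex => P FP0; have FP' : F [set b | bad b -> P b] := FP0.
  apply: contrapT => nP; apply: nF; apply: (@filterS _ F _ _ _ _ FP') => b /= bP.
  by apply: contrapT => /bP Pb; apply: nP; exists b.
have [U [UU FU]] := ultraFilterLemma FbadP.
have UP : ProperFilter U by exact: (@ultra_proper _ _ UU).
have FsubU A : F A -> U A.
  move=> FA; apply: FU; suff : F [set b | bad b -> A b] by exact.
  by apply: filterS FA => b Ab _.
have Ubad : U bad.
  by apply: FU; suff : F [set b | bad b -> bad b] by []; apply: filterE => b.
have /choice[u uP] : forall b, exists f : dual X,
    rnorm f <= 1 /\ f (x + x_ b) = of_real s (rnorm (x + x_ b)).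
  by move=> b; have [f f1 fx] := exists_norming_functional (x + x_ b); exists f.
have u1 b : rnorm (u b) <= 1 by have [] := uP b.
have [l [l1 lP]] := ultra_functional_limit UU u1.
pose f_ b := u b - l.
have f_bounded b : rnorm (f_ b) <= 2.
  by apply: le_trans (ler_rnormB _ _) _; have := u1 b; lra.
have lf : limsup_le U f_ l 1.
  move=> d d0; apply: filterE => b /=.
  by rewrite /f_ addrC subrK; have := u1 b; lra.
have [w w1 wy] := exists_norming_functional y.
pose v := of_real s (rnorm l) *: w.
have vl : rnorm v <= rnorm l.
  by rewrite rnorm_scaler ?rnorm_ge0// ler_piMr ?rnorm_ge0.
have vy : v y = of_real s (rnorm l * rnorm y).
  by rewrite /v opZ wy of_realM.
have [q [q1 q2]] := skew_defect KX.
have fv := @weak_star_null_limsup_le R s X nX KX D U f_ 2 UP (ler0n R 2)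
  f_bounded lP q q1 q2 v l 1 ler01 vl lf.
have n0 : 0 <= n^-1 by rewrite invr_ge0 ltW.
pose M := 1 / n + c + 5.
have M0 : 0 < M.
  by rewrite /M mul1r; lra.
pose d := Num.min 1 (e / (2 * M)).
have d0 : 0 < d by rewrite lt_min ltr01 divr_gt0// mulr_gt0.
have d1 : d <= 1 by rewrite ge_min lexx.
have dM : d * (2 * M) <= e by rewrite -ler_pdivlMr ?mulr_gt0// ge_min lexx orbT.
have [b [[[[[[/= h1 h2] h3] h4] h5] h6] h7]] := filter_ex (filterI (filterI (filterI (filterI
  (filterI (filterI Ubad (fv d d0)) (FsubU _ (yc d d0)))
  (FsubU _ (x_null v d0))) (FsubU _ (x_null l d0))) (lP x d d0)) (lP y d d0)).
apply: h1.
have fE z : f_ b z = u b z - l z by [].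
have ux : rnorm (x + x_ b) = real_part (l x) + real_part (l (x_ b))
    + real_part (f_ b x) + real_part (f_ b (x_ b)).
  rewrite -[LHS](of_realK (s := s)) -(uP b).2 map_opD real_partD !fE !real_partB; ring.
have vE : real_part ((v + f_ b) (y + x_ b)) = rnorm l * rnorm y + real_part (v (x_ b))
    + real_part (f_ b y) + real_part (f_ b (x_ b)).
  by rewrite opD !map_opD vy !real_partD of_realK; ring.
have g1 := real_part_dual_le (v + f_ b) (y + x_ b).
have g2 : rnorm (v + f_ b) * rnorm (y + x_ b) <= (1 / n + d) * (c + d).
  by rewrite ler_pM ?rnorm_ge0.
have g3 : real_part (l x) <= rnorm l * rnorm y.
  apply: le_trans (real_part_dual_le l x) _.
  by rewrite ler_wpM2l ?rnorm_ge0.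
have g4 := le_trans (real_part_le_norm (l (x_ b))) h5.
have g5 : - d <= real_part (v (x_ b)).
  by apply: le_trans (real_part_ge_norm _); rewrite lerN2.
have g6 : real_part (f_ b x) <= d := le_trans (real_part_le_norm _) h6.
have g7 : - d <= real_part (f_ b y).
  by apply: le_trans (real_part_ge_norm _); rewrite lerN2.
have g8 : (1 / n + d) * (c + d) <= c / n + d * (1 / n + c + 1).
  have : d * d <= d by rewrite ler_piMl// ltW.
  by rewrite mul1r; lra.
move: dM; rewrite /M; lra.
Qed.

End WeaklyNullFamilies.

(** * From filters to nets *)

Section Nets.
Context {R : realType} {D : Type}.
Variable le : D -> D -> Prop.
Hypothesis le_dir : directed_preorder le.

Lemma net_filter_proper : ProperFilter (net_filter le).
Proof.
have [[a0] refl trans upper] := le_dir.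
apply: filter_from_proper; first apply: filter_from_filter.
- by exists a0.
- move=> a b _ _; have [c [ac bc]] := upper a b; exists c => // d cd.
  by split; exact: trans cd.
by move=> a _; exists a; exact: refl.
Qed.

Lemma net_limsup_le (r1 r2 : D -> R) (k : R) : 0 < k ->
  (forall b, 0 <= r2 b) ->
  (forall c : R, 0 <= c ->
    (forall e : R, 0 < e -> net_filter le [set b | r2 b <= c + e]) ->
    (forall e : R, 0 < e -> net_filter le [set b | r1 b <= c / k + e])) ->
  (k%:E * net_limsup le r1 <= net_limsup le r2)%E.
Proof.
move=> k0 r20 h; apply: le_ereal_inf_tmp => _ [a _ <-].
set S := ereal_sup _.
have S0 : (0 <= S)%E.
  apply: (@le_trans _ _ (r2 a)%:E); first by rewrite lee_fin.
  apply: ereal_sup_ubound; exists a => //; exact: directed_refl.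
have r2S b : le a b -> ((r2 b)%:E <= S)%E.
  by move=> ab; apply: ereal_sup_ubound; exists b.
move: S S0 r2S => [c| |] S0 r2S; [|by rewrite leey|by move: S0; rewrite leeNy_eq].
rewrite lee_fin in S0.
apply/lee_addgt0Pr => e e0.
have ek0 : 0 < e / k by rewrite divr_gt0.
have [|a' _ ha'] := h c S0 _ (e / k) ek0.
  move=> d d0; exists a => // b /r2S; rewrite lee_fin /= => /le_trans; apply.
  by rewrite lerDl ltW.
apply: (@le_trans _ _ (k%:E * (c / k + e / k)%:E)%E).
  rewrite lee_pmul2l//; apply: le_trans (ereal_inf_lbound _) _.
    by exists a'.
  by apply: ge_ereal_sup => _ [b /ha' bh <-]; rewrite lee_fin.
rewrite -EFinM -EFinD lee_fin -mulrDl mulrC divfK// gt_eqF//.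
Qed.

End Nets.

Section NetHypotheses.
Context {R : realType} {s : scalars}.
Local Notation K := (scalar_field R s).

Lemma bounded_fun_rnorm (D : Type) (V : normedModType K) (f : D -> V) :
  bounded_fun f -> exists2 B : R, 0 <= B & forall b, rnorm (f b) <= B.
Proof.
move=> /pinfty_ex_gt0[M M0 fM]; exists (real_part M).
  by apply: real_part_ge0; exact: ltW.
by move=> b; apply: le_real_part; exact: fM.
Qed.

Lemma cvg0_eventually_small (D : Type) (F : set_system D) (h : D -> K^o) (e : R) :
  Filter F -> h b @[b --> F] --> (0 : K^o) -> 0 < e -> F [set b | rnorm (h b) <= e].
Proof.
move=> FF hF e0.
have e0' : 0 < of_real s e by rewrite -(of_real0 (s := s)) of_real_lt.
have := @cvgr0_norm_le _ _ _ _ FF _ hF _ e0'; apply: filterS => b /=.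
by rewrite -of_real_rnorm of_real_le.
Qed.

End NetHypotheses.

Theorem proposition2p8 (R : realType) (s : scalars)
    (X : completeNormedModType (scalar_field R s))
    (infX : infinite_dimensional X)
    (nX : 0 < numerical_index X)
    (KX : M_ideal (compact_operators_v nX)) :
  (forall x y : X, `|x| <= `|y| ->
    forall (D : Type) (le : D -> D -> Prop) (x_ : D -> X),
      directed_preorder le -> bounded_fun x_ -> weakly_null le x_ ->
      ((numerical_index X)%:E * net_limsup le (fun b => rnorm (x + x_ b)) <=
       net_limsup le (fun b => rnorm (y + x_ b)))%E) /\
  (forall f g : dual X, `|f| <= `|g| ->
    forall (D : Type) (le : D -> D -> Prop) (f_ : D -> dual X),
      directed_preorder le -> bounded_fun f_ -> weak_star_null le f_ ->
      ((numerical_index X)%:E * net_limsup le (fun b => rnorm (f + f_ b)) <=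
       net_limsup le (fun b => rnorm (g + f_ b)))%E).
Proof.
split=> [x y xy D le x_ le_dir _ x_null|f g fg D le f_ le_dir f_bounded f_null].
  have FP := net_filter_proper le_dir.
  apply: net_limsup_le => // [b|c c0 yc]; first exact: rnorm_ge0.
  apply: (weakly_null_limsup_le KX FP _ c0 _ yc); last by rewrite rnorm_le.
  by move=> h e e0; exact: (cvg0_eventually_small _ (x_null h) e0).
have FP := net_filter_proper le_dir.
have [B B0 fB] := bounded_fun_rnorm f_bounded.
have [q [q1 q2]] := skew_defect KX.
apply: net_limsup_le => // [b|c c0 gc]; first exact: rnorm_ge0.
apply: (weak_star_null_limsup_le KX FP B0 fB _ q1 q2 c0 _ gc); last by rewrite rnorm_le.
by move=> x e e0; exact: (cvg0_eventually_small _ (f_null x) e0).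
Qed.
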